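(* For every integer $k\ge3$ there are constants $c_k>0$ and $C_k$ such that the following holds. Let $\varepsilon\in(0,\frac12)$, let $r\ge1$, and let $H$ be a $k$-partite $k$-graph with all parts of size $n$. Suppose that for all vertices $v_1,\dots,v_{k-2}\in V(H)$ lying in distinct parts, the bipartite graph $L(v_1,\dots,v_{k-2})$ has an $\varepsilon'$-homogeneous partition of size at most $r$, where $\varepsilon'=c_k\varepsilon^6$. Then $H$ has an $\varepsilon$-homogeneous equipartition into at most $2^{(r/\varepsilon)^{C_k}}$ parts (of each part of $H$).
   Context: A $k$-partite $k$-graph $H$ has vertex set partitioned into parts $A_1,\dots,A_k$ and every edge contains exactly one vertex of each part. For vertices $v_1,\dots,v_{k-2}$ in distinct parts, $L(v_1,\dots,v_{k-2})$ is the bipartite graph between the two parts not containing any $v_i$, whose edges are the pairs $\{x,y\}$ with $\{x,y,v_1,\dots,v_{k-2}\}\in E(H)$. For a bipartite graph with parts $X,Y$, a pair $(X',Y')$ with $X'\subseteq X,Y'\subseteq Y$ is $\gamma$-homogeneous if $d(X',Y')=e(X',Y')/(|X'||Y'|)\in[0,\gamma]\cup[1-\gamma,1]$; a partition $X=X_1\cup\dots\cup X_s$, $Y=Y_1\cup\dots\cup Y_t$ is $\gamma$-homogeneous if the sum of $|X_i||Y_j|$ over non-$\gamma$-homogeneous pairs $(X_i,Y_j)$ is at most $\gamma|X||Y|$; its size is at most $r$ if $s,t\le r$. Similarly, for $X_i\subseteq A_i$, $(X_1,\dots,X_k)$ is $\varepsilon$-homogeneous if $d(X_1,\dots,X_k)=e(X_1,\dots,X_k)/(|X_1|\cdots|X_k|)\in[0,\varepsilon]\cup[1-\varepsilon,1]$.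 A partition of $H$ consists of a partition $\mathcal P_i$ of $A_i$ for every $i$; it is $\varepsilon$-homogeneous if the sum of $|X_1|\cdots|X_k|$ over non-$\varepsilon$-homogeneous $(X_1,\dots,X_k)\in\mathcal P_1\times\dots\times\mathcal P_k$ is at most $\varepsilon|A_1|\cdots|A_k|$, and it is an equipartition if all parts of each $\mathcal P_i$ have equal size.
   Formalization: ''Equal size'' in the equipartition is read as sizes differing by at most one within each part of H; with exactly equal sizes the claim fails, e.g. for large prime n and the even-parity hypergraph on near-halves of each part. *)

(* Defs.v *)
From mathcomp Require Import all_boot all_order all_algebra.
From mathcomp Require Import reals exp.
Set Implicit Arguments.
Unset Strict Implicit.
Unset Printing Implicit Defensive.
Import Order.TTheory GRing.Theory Num.Theory.
Local Open Scope ring_scope.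

Record kpartite_kgraph (k : nat) := KPartiteKGraph {
  vert : finType;
  part : 'I_k -> {set vert};
  edges : {set {set vert}};
  part_disjoint : forall i j, i != j -> [disjoint part i & part j];
  part_cover : \bigcup_i part i = [set: vert];
  edge_transversal : forall e, e \in edges -> forall i, #|e :&: part i| = 1%N
}.

Definition homogeneous_density (R : realType) (g d : R) : bool :=
  (0 <= d <= g) || (1 - g <= d <= 1).

(* A bipartite graph with parts X and Y is given by a relation e, of which only
   the values e x y with x in X and y in Y matter.  The blocks of a [partition]
   are nonempty, so the densities below never divide by zero. *)
Section Bipartite.
Variables (R : realType) (V : finType) (e : rel V).

Definition bip_density (X Y : {set V}) : R :=
  #|[set p in setX X Y | e p.1 p.2]|%:R / (#|X|%:R * #|Y|%:R).

Definition bip_homogeneous (g : R) (X Y : {set V}) : bool :=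
  homogeneous_density g (bip_density X Y).

Definition bip_homogeneous_partition (g : R) (X Y : {set V})
    (PX PY : {set {set V}}) : Prop :=
  [/\ partition PX X, partition PY Y &
      \sum_(X' in PX) \sum_(Y' in PY | ~~ bip_homogeneous g X' Y')
        (#|X'|%:R * #|Y'|%:R) <= g * #|X|%:R * #|Y|%:R].

Definition has_bip_homogeneous_partition (g r : R) (X Y : {set V}) : Prop :=
  exists PX PY : {set {set V}},
    [/\ bip_homogeneous_partition g X Y PX PY,
        #|PX|%:R <= r & #|PY|%:R <= r].

End Bipartite.

Section Hypergraph.
Variables (R : realType) (k : nat) (H : kpartite_kgraph k).

Definition link (v : 'I_(k - 2) -> vert H) : rel (vert H) :=
  fun x y => [set x; y] :|: [set v l | l : 'I_(k - 2)] \in edges H.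

Definition density (X : 'I_k -> {set vert H}) : R :=
  #|[set e in edges H | [forall i, #|e :&: X i| == 1%N]]|%:R
  / \prod_i #|X i|%:R.

Definition homogeneous (g : R) (X : 'I_k -> {set vert H}) : bool :=
  homogeneous_density g (density X).

Definition kpartition (P : 'I_k -> {set {set vert H}}) : Prop :=
  forall i, partition (P i) (part H i).

Definition homogeneous_kpartition (g : R) (P : 'I_k -> {set {set vert H}}) :
    Prop :=
  kpartition P /\
  \sum_(X : {ffun 'I_k -> {set vert H}} | (X \in family P) && ~~ homogeneous g X)
    \prod_i #|X i|%:R <= g * \prod_i #|part H i|%:R.

(* Equal sizes are meant up to rounding: when n is prime, blocks of exactly
   equal size only leave the partitions into 1 or n blocks. *)
Definition equitable (P : 'I_k -> {set {set vert H}}) : Prop :=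
  forall i (B B' : {set vert H}),
    B \in P i -> B' \in P i -> (#|B| <= #|B'|.+1)%N.

End Hypergraph.

(* Main.v *)
Require Import Defs.
From mathcomp Require Import all_boot all_order all_algebra.
From mathcomp Require Import boolp reals exp.
From mathcomp Require Import zify ring lra.
Set Implicit Arguments.
Unset Strict Implicit.
Unset Printing Implicit Defensive.
Import Order.TTheory GRing.Theory Num.Theory.
Local Open Scope ring_scope.

(* Fix a part and classify its vertices x so that the class of x determines its
   link up to a small error; when this is done for every part, averaging over
   the classes one coordinate at a time changes the indicator of H little in L^1,
   which forces most cells to have density near 0 or 1.

   The classification is by induction on the number of the other coordinates.
   Sample m = poly(r / eps) values w_l of one of them and z_j of another.  By
   induction the slices at w_l and at z_j come with classifications of x, and the
   new class of x is the tuple of all these classes, so the number of classes is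
   raised to the power 2m at each step.  It determines the link: for fixed other
   coordinates y, the bipartite graph of pairs (z, w) has about r distinct rows,
   the clusters of rows can be recovered from the columns w_l, and the content
   of each cluster from the rows z_j.  Recovering both by minimising the observed
   error makes the loss linear at each step, independently of r and m. *)

(** * Averages and sampling *)

Section Average.
Variable R : realFieldType.

(** Division by zero makes the average over an empty type 0, whence the nonnegative constant in
    [avg_le_const] and the inhabitants asked for elsewhere. *)
Definition avg (T : finType) (F : T -> R) : R := (\sum_t F t) / #|T|%:R.

Lemma eq_avg (T : finType) (F G : T -> R) : F =1 G -> avg F = avg G.
Proof. by move=> FG; rewrite /avg (eq_bigr _ (fun t _ => FG t)). Qed.

Lemma avgD (T : finType) (F G : T -> R) :
  avg (fun t => F t + G t) = avg F + avg G.
Proof. by rewrite /avg big_split mulrDl. Qed.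

Lemma avgZ (T : finType) (c : R) (F : T -> R) :
  avg (fun t => c * F t) = c * avg F.
Proof. by rewrite /avg -mulr_sumr mulrA. Qed.

Lemma avgN (T : finType) (F : T -> R) : avg (fun t => - F t) = - avg F.
Proof. by rewrite /avg sumrN mulNr. Qed.

Lemma avg_sum (T I : finType) (F : I -> T -> R) :
  avg (fun t => \sum_i F i t) = \sum_i avg (F i).
Proof. by rewrite /avg exchange_big mulr_suml. Qed.

Lemma avg_swap (S T : finType) (F : S -> T -> R) :
  avg (fun s => avg (F s)) = avg (fun t => avg (F^~ t)).
Proof.
rewrite /avg -!mulr_suml exchange_big /= -!mulrA; congr (_ * _).
by rewrite mulrC.
Qed.

Lemma avg_pair (S T : finType) (F : S * T -> R) :
  avg F = avg (fun s => avg (fun t => F (s, t))).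
Proof.
rewrite /avg -mulr_suml pair_bigA /= card_prod natrM invfM -mulrA.
congr (_ * _); last by rewrite mulrC.
by apply: eq_bigr => -[].
Qed.

Lemma ler_avg (T : finType) (F G : T -> R) :
  (forall t, F t <= G t) -> avg F <= avg G.
Proof.
by move=> FG; rewrite ler_wpM2r ?invr_ge0 ?ler0n// ler_sum.
Qed.

Lemma avg_ge0 (T : finType) (F : T -> R) : (forall t, 0 <= F t) -> 0 <= avg F.
Proof. by move=> F0; rewrite mulr_ge0 ?invr_ge0 ?ler0n// sumr_ge0. Qed.

Lemma avg_const (T : finType) (t0 : T) (c : R) : avg (fun _ : T => c) = c.
Proof.
rewrite /avg sumr_const -[c *+ _]mulr_natr mulfK// pnatr_eq0 -lt0n.
by apply/card_gt0P; exists t0.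
Qed.

Lemma avg_le_const (T : finType) (F : T -> R) (c : R) :
  0 <= c -> (forall t, F t <= c) -> avg F <= c.
Proof.
move=> c0 Fc; case: (pickP [pred t : T | true]) => [t0 _|T0].
  by rewrite -[leRHS](avg_const t0); apply: ler_avg.
by rewrite /avg big1 ?mul0r// => t; have := T0 t.
Qed.

Lemma avg_le0_witness (T : finType) (t0 : T) (F : T -> R) :
  avg F <= 0 -> exists t, F t <= 0.
Proof.
move=> F0; case: (pickP [pred t | F t <= 0]) => [t Ft|Fpos]; first by exists t.
have Fgt0 t : 0 < F t by have := Fpos t; rewrite /= real_leNgt ?num_real// => /negbFE.
suff : 0 < avg F by rewrite ltNge F0.
rewrite divr_gt0//; last by rewrite ltr0n; apply/card_gt0P; exists t0.
rewrite (bigD1 t0)//= ltr_wpDr// sumr_ge0// => t _; exact: ltW.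
Qed.

Lemma indicator_triangle (T : eqType) (x y z : T) :
  (x != z)%:R <= (x != y)%:R + (y != z)%:R :> R.
Proof.
rewrite -natrD ler_nat; case: (eqVneq x y) => [->//|_].
exact: leq_trans (leq_b1 _) (leq_addr _ _).
Qed.

(* Greedy derandomisation of the second moment method: a uniformly random next
   sample does not increase the potential by more than the sum of weights. *)
Lemma greedy_sample (W I : finType) (w0 : W) (a : I -> R) (F : I -> W -> R)
    (L : W -> R) (m : nat) :
  (forall i, 0 <= a i) -> (forall i w, 0 <= F i w <= 1) ->
  exists s : m.-tuple W,
    \sum_i a i * (\sum_(w <- s) (F i w - avg (F i))) ^+ 2 +
    \sum_(w <- s) (L w - avg L) <= m%:R * \sum_i a i.
Proof.
move=> a0 F01.
elim: m => [|m [s IH]].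
  exists [tuple]; rewrite big_nil mul0r addr0 big1 // => i _.
  by rewrite big_nil expr0n mulr0.
pose S i := \sum_(w <- s) (F i w - avg (F i)).
(* The part of the increment of the potential that is linear in the deviations. It averages to 0
   over [w], so some [w] makes it nonpositive; the squares left over cost at most [a i] each. *)
pose Q w := \sum_i (a i * 2 * S i) * (F i w - avg (F i)) + (L w - avg L).
have avg_dev (G : W -> R) : avg (fun w => G w - avg G) = 0.
  by rewrite avgD avgN (avg_const w0) subrr.
have [|w Qw] := @avg_le0_witness _ w0 Q.
  rewrite /Q avgD avg_dev addr0 avg_sum big1// => i _.
  by rewrite avgZ avg_dev mulr0.
exists [tuple of w :: s].
rewrite big_cons -natr1 mulrDl mul1r.
apply: le_trans (lerD IH (lexx _)).
have step : \sum_i a i * (\sum_(w1 <- w :: s) (F i w1 - avg (F i))) ^+ 2 <=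
   \sum_i (a i * S i ^+ 2 + (a i * 2 * S i) * (F i w - avg (F i)) + a i).
  apply: ler_sum => i _; rewrite big_cons -/(S i).
  have /andP[f0 f1] := F01 i w.
  have A0 : 0 <= avg (F i) by apply: avg_ge0 => v; case/andP: (F01 i v).
  have A1 : avg (F i) <= 1.
    by apply: avg_le_const => // v; case/andP: (F01 i v).
  rewrite [leRHS](_ : _ = a i * (S i ^+ 2 + 2 * S i * (F i w - avg (F i)) + 1)); last by ring.
  apply: ler_wpM2l => //.
  set d := F i w - avg (F i).
  have : d ^+ 2 <= 1 by rewrite /d; nra.
  nra.
move: step Qw; rewrite /Q !big_split /= -/(S _); lra.
Qed.

(** Turns second moments into first moments; multiplied by [mu], it is an instance of the
    arithmetic-geometric mean inequality. *)
Lemma ler_norm_sqr (mu t : R) : 0 < mu -> `|t| <= mu + t ^+ 2 / mu.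
Proof.
move=> mu0; rewrite -[t ^+ 2]real_normK ?num_real//.
have := normr_ge0 t; move: `|t| => x x0.
rewrite -(ler_pM2r mu0) mulrDl mulfVK ?gt_eqF//; nra.
Qed.

(** One sample serves all deviations and the cost [L] at once. By [ler_norm_sqr] with
    [mu = d / (2 * A)], half of [d] pays for [mu * \sum_i a i] and the other half for the second
    moment bound [A / m] divided by [mu]. *)
Lemma sample (W I : finType) (w0 : W) (a : I -> R) (F : I -> W -> R)
    (L : W -> R) (m : nat) (A d : R) :
  (forall i, 0 <= a i) -> \sum_i a i <= A -> 0 < A -> 0 < d ->
  (forall i w, 0 <= F i w <= 1) -> 4 * A ^+ 2 / d ^+ 2 <= m%:R ->
  exists s : 'I_m -> W,
    \sum_i a i * `|avg (fun l => F i (s l)) - avg (F i)| +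
    avg (fun l => L (s l)) <= avg L + d.
Proof.
move=> a0 aA A0 d0 F01 mA.
pose mu := d / (2 * A).
have mu0 : 0 < mu by rewrite divr_gt0// mulr_gt0.
have m0 : 0 < m%:R :> R.
  by apply: lt_le_trans mA; rewrite !divr_gt0 ?mulr_gt0 ?exprn_gt0.
(* The weight [m%:R * mu] leaves coefficient 1 on [L] after division by [m ^ 2] and then by [mu]. *)
have [s hs] := greedy_sample w0 (fun w => m%:R * mu * L w) m a0 F01.
exists (tnth s).
have avgE (G : W -> R) : m%:R * (avg (fun l => G (tnth s l)) - avg G) = \sum_(w <- s) (G w - avg G).
  rewrite mulrBr /avg card_ord mulrC mulfVK ?gt_eqF// big_tuple sumrB.
  by rewrite sumr_const card_ord mulr_natl.
move: hs; rewrite (eq_bigr (fun i => m%:R ^+ 2 * (a i * (avg (fun l => F i (tnth s l)) - avg (F i)) ^+ 2))); last first.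
  by move=> i _; rewrite -avgE; ring.
rewrite -mulr_sumr -avgE !avgZ.
set V := \sum_i _; set l1 := avg (fun l => L _); set l0 := avg L => hs.
have {}hs : V + mu * (l1 - l0) <= A / m%:R.
  rewrite ler_pdivlMr// -(ler_pM2l m0); apply: le_trans (_ : m%:R * \sum_i a i <= _); last first.
    by rewrite ler_pM2l.
  apply: le_trans hs; rewrite le_eqVlt; apply/orP; left; apply/eqP; ring.
have h1 : \sum_i a i * `|avg (fun l => F i (tnth s l)) - avg (F i)| <=
    \sum_i (mu * a i + mu^-1 * (a i * (avg (fun l => F i (tnth s l)) - avg (F i)) ^+ 2)).
  apply: ler_sum => i _; apply: le_trans (ler_wpM2l (a0 i) (ler_norm_sqr _ mu0)) _.
  by rewrite le_eqVlt; apply/orP; left; apply/eqP; ring.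
apply: le_trans (lerD h1 (lexx _)) _.
rewrite big_split /= -!mulr_sumr -/V.
have h2 : mu * \sum_i a i <= d / 2.
  rewrite (_ : d / 2 = mu * A); first by rewrite ler_pM2l.
  by rewrite /mu; field; rewrite gt_eqF.
have h3 : mu^-1 * (V + mu * (l1 - l0)) <= d / 2.
  apply: le_trans (ler_wpM2l _ hs) _; first by rewrite invr_ge0 ltW.
  rewrite mulrA ler_pdivrMr// /mu; move: mA.
  rewrite ler_pdivrMr ?exprn_gt0// => mA.
  rewrite -(ler_pM2r d0) (_ : _ * d = 2 * A ^+ 2); last by field; rewrite !gt_eqF.
  by move: mA; rewrite !expr2; lra.
by move: h3; rewrite mulrDr mulrA mulVf ?gt_eqF// mul1r; lra.
Qed.

End Average.

(** * One more coordinate *)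

Section Step.
Variable R : realFieldType.

(** Weight [1 / #|S|] on each pair [(s, j)] makes the total weight at most [#|J|], so the sample
    size does not depend on [S]. *)
Lemma sample_avg (W S J : finType) (w0 : W) (F : S -> J -> W -> R)
    (L : W -> R) (m : nat) (A d : R) :
  #|J|%:R <= A -> 0 < A -> 0 < d ->
  (forall s j w, 0 <= F s j w <= 1) -> 4 * A ^+ 2 / d ^+ 2 <= m%:R ->
  exists w : 'I_m -> W,
    avg (fun s => \sum_j `|avg (fun l => F s j (w l)) - avg (F s j)|) +
    avg (fun l => L (w l)) <= avg L + d.
Proof.
move=> JA A0 d0 F01 mA.
have [||w hw] := @sample R W (S * J)%type w0 (fun=> #|S|%:R^-1)
  (fun i => F i.1 i.2) L m A d _ _ A0 d0 (fun i => F01 i.1 i.2) mA.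
- by move=> _; rewrite invr_ge0.
- rewrite sumr_const -[_ *+ _]mulr_natr card_prod natrM mulrA.
  case: (#|S|) => [|n]; first by rewrite mulr0 mul0r ltW.
  by rewrite mulVf ?pnatr_eq0// mul1r.
exists w; apply: le_trans hw; rewrite lerD2r /avg mulrC mulr_sumr.
under [leLHS]eq_bigr do rewrite mulr_sumr.
by rewrite pair_bigA.
Qed.

Lemma exists_min (T : finType) (t0 : T) (F : T -> R) :
  exists t, forall t', F t <= F t'.
Proof.
by case: (@arg_minP _ _ T t0 xpredT F isT) => t _ tP; exists t => t'; exact: tP.
Qed.

Lemma exists_min_fun (S T : finType) (t0 : T) (F : (S -> T) -> R) :
  (forall u v, u =1 v -> F u = F v) -> exists u, forall v, F u <= F v.
Proof.
move=> Fext; have [u hu] := exists_min [ffun _ : S => t0] (fun u : {ffun S -> T} => F u).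
by exists u => v; rewrite (Fext v [ffun s => v s]) => [|s]; rewrite ?ffunE.
Qed.

Lemma exists_best_blocks (Z : finType) (r m : nat) (i0 : 'I_r)
    (gh : Z -> 'I_m -> bool) :
  exists cv : (Z -> 'I_r) * ('I_r -> 'I_m -> bool), forall (c2 : Z -> 'I_r) v2,
    avg (fun z => avg (fun l => (gh z l != cv.2 (cv.1 z) l)%:R : R)) <=
    avg (fun z => avg (fun l => (gh z l != v2 (c2 z) l)%:R : R)).
Proof.
pose T := ({ffun Z -> 'I_r} * {ffun 'I_r * 'I_m -> bool})%type.
have [u hu] := exists_min ([ffun => i0], [ffun => true] : _) (fun u : T =>
  avg (fun z => avg (fun l => (gh z l != u.2 (u.1 z, l))%:R : R))).
exists (u.1 : _ -> _, fun i l => u.2 (i, l)) => c2 v2.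
apply: le_trans (hu ([ffun z => c2 z], [ffun il => v2 il.1 il.2])) _ => /=.
rewrite le_eqVlt; apply/orP; left; apply/eqP.
by apply: eq_avg => z; apply: eq_avg => l; rewrite !ffunE.
Qed.

(* Reclustering the observed rows [gh] can only be better than the true
   clustering [c]; sending each new cluster to the nearest true row and comparing
   the at most [r] true rows on the sample transfers the bound to all columns. *)
Lemma recluster (Z W : finType) (r m : nat) (i0 : 'I_r) (G : Z -> W -> bool)
    (c : Z -> 'I_r) (B : 'I_r -> W -> bool) (s : 'I_m -> W)
    (gh : Z -> 'I_m -> bool) (c' : Z -> 'I_r) (v : 'I_r -> 'I_m -> bool) :
  (forall (c2 : Z -> 'I_r) v2,
    avg (fun z => avg (fun l => (gh z l != v (c' z) l)%:R : R)) <=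
    avg (fun z => avg (fun l => (gh z l != v2 (c2 z) l)%:R))) ->
  exists D : 'I_r -> W -> bool,
    avg (fun z => avg (fun w => (G z w != D (c' z) w)%:R : R)) <=
    avg (fun z => avg (fun w => (G z w != B (c z) w)%:R)) +
    4 * (avg (fun z => avg (fun l => (G z (s l) != gh z l)%:R)) +
         avg (fun z => avg (fun l => (G z (s l) != B (c z) (s l))%:R))) +
    \sum_(a : 'I_r * 'I_r)
      `|avg (fun l => (B a.1 (s l) != B a.2 (s l))%:R) -
        avg (fun w => (B a.1 w != B a.2 w)%:R)|.
Proof.
move=> cvmin.
have [sg hsg] := @choice _ _ (fun i a => forall a',
    avg (fun l => (B a (s l) != v i l)%:R : R) <= avg (fun l => (B a' (s l) != v i l)%:R))
  (fun i => exists_min i0 (fun a => avg (fun l => (B a (s l) != v i l)%:R))).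
exists (fun i w => B (sg i) w).
set dev := \sum_a _; set e1 := avg (fun z => avg (fun l => (G z (s l) != gh z l)%:R)).
set e2 := avg (fun z => avg (fun l => (G z (s l) != B (c z) (s l))%:R)).
(* The competitor is the true clustering with the true rows read on the sample. *)
have h1 : avg (fun z => avg (fun l => (gh z l != v (c' z) l)%:R)) <= e1 + e2.
  apply: le_trans (cvmin c (fun i l => B i (s l))) _.
  rewrite -avgD; apply: ler_avg => z; rewrite -avgD; apply: ler_avg => l.
  by rewrite [in leRHS](eq_sym (G z (s l)) (gh z l)); exact: indicator_triangle.
have h2 : avg (fun z => avg (fun l => (B (c z) (s l) != v (c' z) l)%:R)) <= 2 * (e1 + e2).
  apply: (@le_trans _ _ (e2 + (e1 + avg (fun z => avg (fun l => (gh z l != v (c' z) l)%:R))))); last by lra.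
  rewrite -!avgD; apply: ler_avg => z; rewrite -!avgD; apply: ler_avg => l.
  apply: le_trans (indicator_triangle R _ (G z (s l)) _) _.
  by rewrite eq_sym lerD2l; exact: indicator_triangle.
(* The error doubles because [sg (c' z)] is at least as close to [v (c' z)] as the row [c z] is. *)
have h3 : avg (fun z => avg (fun l => (B (c z) (s l) != B (sg (c' z)) (s l))%:R)) <= 4 * (e1 + e2).
  apply: (@le_trans _ _ (2 * avg (fun z => avg (fun l => (B (c z) (s l) != v (c' z) l)%:R)))); last by lra.
  rewrite -avgZ; apply: ler_avg => z; rewrite mulrDl mul1r.
  apply: le_trans (lerD (lexx _) (hsg (c' z) (c z))).
  rewrite -avgD; apply: ler_avg => l.
  by rewrite (eq_sym (B (sg _) _)); exact: indicator_triangle.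
have h4 : avg (fun z => avg (fun w => (B (c z) w != B (sg (c' z)) w)%:R)) <= 4 * (e1 + e2) + dev.
  apply: (@le_trans _ _ (avg (fun z => avg (fun l => (B (c z) (s l) != B (sg (c' z)) (s l))%:R) + dev))); last first.
    by rewrite avgD; apply: lerD => //; apply: avg_le_const; rewrite ?sumr_ge0.
  (* Passing from the sample to all columns costs, for each [z], a single term of [dev]: the one for
     the pair of true rows being compared. *)
  apply: ler_avg => z; rewrite -lerBlDl.
  rewrite /dev (bigD1 (c z, sg (c' z)))//= -[leLHS]addr0 lerD//; last by rewrite sumr_ge0.
  by rewrite distrC ler_norm.
apply: (@le_trans _ _ (avg (fun z => avg (fun w => (G z w != B (c z) w)%:R)) +
   avg (fun z => avg (fun w => (B (c z) w != B (sg (c' z)) w)%:R)))); last by rewrite -addrA lerD2l.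
rewrite -avgD; apply: ler_avg => z; rewrite -avgD; apply: ler_avg => w.
exact: indicator_triangle.
Qed.

(* The new clustering depends on [s] only through its types under the sampled
   [p (w l)], so it may be used by a decoder; [D] may depend on [s] itself and
   only serves as a comparison in [refit_step]. *)
Lemma cluster_step (S Z W T : finType) (w0 : W) (r m : nat) (i0 : 'I_r)
    (f : S -> Z -> W -> bool) (p : W -> S -> T) (g : W -> T -> Z -> bool)
    (c : S -> Z -> 'I_r) (B : S -> 'I_r -> W -> bool) (eta e d : R) :
  0 <= e -> 0 <= eta ->
  (forall w, avg (fun s => avg (fun z => (f s z w != g w (p w s) z)%:R)) <= eta) ->
  (forall s, avg (fun z => avg (fun w => (f s z w != B s (c s z) w)%:R)) <= e) ->
  0 < d -> 4 * (r%:R ^+ 2) ^+ 2 / d ^+ 2 <= m%:R ->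
  exists (w : 'I_m -> W) (c' : {ffun 'I_m -> T} -> Z -> 'I_r)
    (D : S -> 'I_r -> W -> bool),
    avg (fun s => avg (fun z => avg (fun x =>
      (f s z x != D s (c' [ffun l => p (w l) s] z) x)%:R))) <=
    4 * eta + 5 * e + d.
Proof.
move=> e0 eta0 hg hB d0 hm.
(* The cost of a column copies the terms with factor 4 in [recluster]. It averages to at most
   [4 * (eta + e)]; the remaining [e] is the structure error over all columns. *)
pose L w := 4 * (avg (fun s => avg (fun z => (f s z w != g w (p w s) z)%:R)) +
  avg (fun s => avg (fun z => (f s z w != B s (c s z) w)%:R))) : R.
have r0 : 0 < r%:R :> R by rewrite ltr0n; case: i0 => [] [|?] /(leq_ltn_trans (leq0n _)).
have [|||w hw] := @sample_avg W S ('I_r * 'I_r)%type w0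
   (fun s a w => (B s a.1 w != B s a.2 w)%:R) L m (r%:R ^+ 2) d _ _ d0 _ hm.
- by rewrite card_prod !card_ord natrM.
- by rewrite exprn_gt0.
- by move=> s j w; rewrite ler0n lern1 leq_b1.
have [cv hcv] := @choice _ _ _ (fun tau : {ffun 'I_m -> T} =>
  exists_best_blocks i0 (fun z l => g (w l) (tau l) z)).
have [D hD] := @choice _ _ _ (fun s => recluster i0 (f s) (c s) (B s) w
   (hcv [ffun l => p (w l) s])).
exists w, (fun tau => (cv tau).1), D.
apply: le_trans (ler_avg hD) _; rewrite !avgD avgZ avgD.
have h1 : avg L <= 4 * (eta + e).
  rewrite /L avgZ ler_pM2l// avgD lerD//.
    exact: avg_le_const.
  rewrite avg_swap; apply: avg_le_const => // s; rewrite avg_swap; exact: hB.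
have h2 : avg (fun s => avg (fun z => avg (fun w => (f s z w != B s (c s z) w)%:R))) <= e.
  exact: avg_le_const.
have h3 : avg (fun l => L (w l)) =
  4 * (avg (fun s => avg (fun z => avg (fun l =>
         (f s z (w l) != g (w l) ([ffun l => p (w l) s] l) z)%:R))) +
       avg (fun s => avg (fun z => avg (fun l =>
         (f s z (w l) != B s (c s z) (w l))%:R)))).
  rewrite avgZ avgD; congr (_ * (_ + _)); rewrite avg_swap; apply: eq_avg => s.
    by rewrite avg_swap; apply: eq_avg => z; apply: eq_avg => l; rewrite ffunE.
  by rewrite avg_swap.
move: hw; rewrite h3; lra.
Qed.

(** The error of a labelling of clusters depends only on the joint distribution of [(C z, G z)],
    which has [2 * r] atoms and is read off the sample up to [dev]. On the sample [D] beats [D'] for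
    the observed labels [hh], and replacing [G] by [hh] and back costs the label error twice. *)
Lemma refit (Z : finType) (r m : nat) (G : Z -> bool) (C : Z -> 'I_r)
    (s : 'I_m -> Z) (hh : 'I_m -> bool) (D D' : 'I_r -> bool) :
  (forall D2 : 'I_r -> bool, avg (fun j => (hh j != D (C (s j)))%:R : R) <=
    avg (fun j => (hh j != D2 (C (s j)))%:R)) ->
  avg (fun z => (G z != D (C z))%:R : R) <=
    2 * avg (fun j => (G (s j) != hh j)%:R) +
    avg (fun j => (G (s j) != D' (C (s j)))%:R) +
    \sum_(a : 'I_r * bool)
      `|avg (fun j => ((C (s j), G (s j)) == a)%:R) -
        avg (fun z => ((C z, G z) == a)%:R)|.
Proof.
move=> Dmin; set dev := \sum_a _.
have split_err (U : finType) (u : U -> Z) :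
  avg (fun z => (G (u z) != D (C (u z)))%:R : R) =
  \sum_(a : 'I_r * bool) (a.2 != D a.1)%:R * avg (fun z => ((C (u z), G (u z)) == a)%:R).
  under [RHS]eq_bigr do rewrite -avgZ.
  rewrite -avg_sum; apply: eq_avg => z.
  rewrite (bigD1 (C (u z), G (u z)))//= eqxx mulr1 big1 ?addr0// => a.
  by rewrite eq_sym => /negbTE ->; rewrite mulr0.
have h1 : avg (fun z => (G z != D (C z))%:R : R) <=
    avg (fun j => (G (s j) != D (C (s j)))%:R) + dev.
  rewrite (split_err _ id) (split_err _ s) -big_split /=; apply: ler_sum => a _.
  case: (_ != _); rewrite ?mul0r ?add0r// !mul1r -lerBlDl distrC; exact: ler_norm.
apply: le_trans h1 _; rewrite lerD2r mulrDl mul1r -addrA.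
apply: (@le_trans _ _ (avg (fun j => (G (s j) != hh j)%:R) + avg (fun j => (hh j != D (C (s j)))%:R))).
  by rewrite -avgD; apply: ler_avg => j; exact: indicator_triangle.
rewrite lerD2l; apply: le_trans (Dmin D') _.
rewrite -avgD; apply: ler_avg => j.
by rewrite (eq_sym (G (s j)) (hh j)); exact: indicator_triangle.
Qed.

(* Unlike [D'], the decoder [D] sees [s] only through the types [th s] and
   [q (z j) s]. *)
Lemma refit_step (S Z T Th : finType) (z0 : Z) (r m : nat) (i0 : 'I_r)
    (f : S -> Z -> bool) (q : Z -> S -> T) (h : Z -> T -> bool)
    (th : S -> Th) (C : Th -> Z -> 'I_r) (D' : S -> 'I_r -> bool)
    (eta eta' d : R) :
  0 <= eta ->
  (forall z, avg (fun s => (f s z != h z (q z s))%:R) <= eta) ->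
  avg (fun s => avg (fun z => (f s z != D' s (C (th s) z))%:R)) <= eta' ->
  0 < d -> 4 * (2 * r%:R) ^+ 2 / d ^+ 2 <= m%:R ->
  exists (z : 'I_m -> Z) (D : Th -> {ffun 'I_m -> T} -> 'I_r -> bool),
    avg (fun s => avg (fun x =>
      (f s x != D (th s) [ffun j => q (z j) s] (C (th s) x))%:R)) <=
    2 * eta + eta' + d.
Proof.
move=> eta0 hh hD' d0 hm.
pose L z := 2 * avg (fun s => (f s z != h z (q z s))%:R) +
  avg (fun s => (f s z != D' s (C (th s) z))%:R) : R.
have r0 : 0 < r%:R :> R by rewrite ltr0n; case: i0 => [] [|?] /(leq_ltn_trans (leq0n _)).
have [|||z hz] := @sample_avg Z S ('I_r * bool)%type z0
   (fun s a z => ((C (th s) z, f s z) == a)%:R) L m (2 * r%:R) d _ _ d0 _ hm.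
- by rewrite card_prod card_bool card_ord natrM mulrC.
- by rewrite mulr_gt0.
- by move=> s j w; rewrite ler0n lern1 leq_b1.
have [D hD] := @choice _ _ _ (fun u : Th * {ffun 'I_m -> T} =>
  @exists_min_fun 'I_r bool true
    (fun D => avg (fun j => (h (z j) (u.2 j) != D (C u.1 (z j)))%:R))
    (fun D1 D2 D12 => eq_avg (fun j => congr1 (fun b => (_ != b)%:R) (D12 _)))).
exists z, (fun t u => D (t, u)).
apply: le_trans (ler_avg (fun s => refit (f s) (D' s) (hD (th s, [ffun j => q (z j) s])))) _.
rewrite !avgD avgZ.
have h1 : avg L <= 2 * eta + eta'.
  rewrite /L avgD avgZ lerD//.
    by rewrite ler_pM2l//; exact: avg_le_const.
  by rewrite avg_swap.
have h3 : avg (fun l => L (z l)) =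
  2 * avg (fun s => avg (fun j => (f s (z j) != h (z j) ([ffun j => q (z j) s] j))%:R)) +
   avg (fun s => avg (fun j => (f s (z j) != D' s (C (th s) (z j)))%:R)).
  rewrite avgD avgZ; congr (_ * _ + _); rewrite avg_swap; apply: eq_avg => s //.
  by apply: eq_avg => j; rewrite ffunE.
move: hz; rewrite h3; lra.
Qed.

End Step.

(** * Induction on the number of coordinates *)

Section Recursion.
Variable R : realFieldType.

(** Up to error [e] the matrix [G] has at most [r] distinct rows. Columns are not grouped, so that
    the content of a row may be an arbitrary function. *)
Definition row_structured (Z W : finType) (r : nat) (e : R)
    (G : Z -> W -> bool) : Prop :=
  exists (c : Z -> 'I_r) (B : 'I_r -> W -> bool),
    avg (fun z => avg (fun w => (G z w != B (c z) w)%:R)) <= e.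

(* Grouping [x : X] into [N] classes determines the slice [f x], up to an error
   [eta] on average. *)
Definition approximable (X U : finType) (N : nat) (eta : R)
    (f : X -> U -> bool) : Prop :=
  exists (p : X -> 'I_N) (D : 'I_N -> U -> bool),
    avg (fun x => avg (fun u => (f x u != D (p x) u)%:R)) <= eta.

Lemma eq_approximable (X U : finType) (N : nat) (eta : R) (f g : X -> U -> bool) :
  f =2 g -> approximable N eta f -> approximable N eta g.
Proof.
move=> fg [p [D h]]; exists p, D; apply: le_trans h; rewrite le_eqVlt.
by apply/orP; left; apply/eqP/eq_avg => x; apply: eq_avg => u; rewrite fg.
Qed.

Lemma approximable_type (X U T : finType) (N : nat) (eta : R)
    (f : X -> U -> bool) (p : X -> T) (D : T -> U -> bool) :
  #|T| = N -> avg (fun x => avg (fun u => (f x u != D (p x) u)%:R)) <= eta ->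
  approximable N eta f.
Proof.
move=> <- h; exists (fun x => enum_rank (p x)), (fun i => D (enum_val i)).
by under eq_avg do under eq_avg do rewrite enum_rankK.
Qed.

(** The class of [x] consists of its classes for [m] slices at values of [w] and [m] slices at
    values of [z], whence [N ^ (m + m)]. Clustering costs [4 * eta + 6 * e] and refitting adds
    [2 * eta + e]. The bound on [m] covers both samples, which need [4 * r ^ 4 / e ^ 2] and
    [16 * r ^ 2 / e ^ 2]. *)
Lemma approximable_step (X Z W Y : finType) (z0 : Z) (w0 : W)
    (r m N : nat) (r0 : (0 < r)%N) (f : X -> Z -> W -> Y -> bool)
    (eta e : R) :
  0 <= eta -> 0 < e -> 16 * r%:R ^+ 4 / e ^+ 2 <= m%:R ->
  (forall w, approximable N eta (fun x (u : Z * Y) => f x u.1 w u.2)) ->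
  (forall z, approximable N eta (fun x (u : W * Y) => f x z u.1 u.2)) ->
  (forall x y, row_structured r e (fun z w => f x z w y)) ->
  approximable (N ^ (m + m)) (6 * eta + 7 * e)
    (fun x (u : Z * (W * Y)) => f x u.1 u.2.1 u.2.2).
Proof.
move=> eta0 e0 hm /choice[p /choice[g hg]] /choice[q /choice[h hh]] hc.
have /choice[c /choice[B hB]] : forall s : X * Y, row_structured r e (fun z w => f s.1 z w s.2).
  by case.
have r1 : 1 <= r%:R :> R by rewrite ler1n.
have e2 : 0 < (e ^+ 2)^-1 by rewrite invr_gt0 exprn_gt0.
have r41 : 1 <= r%:R ^+ 4 :> R by exact: exprn_ege1.
have r2 : r%:R ^+ 2 <= r%:R ^+ 4 :> R by exact: ler_weXn2l.
(* The instances are pairs [(x, y)]. The decoder is given [y], so [y] may be part of the type of an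
   instance. *)
have [||w [c' [D' hD']]] := @cluster_step R (X * Y)%type Z W ('I_N * Y)%type w0 r m (Ordinal r0)
   (fun s z w => f s.1 z w s.2) (fun w s => (p w s.1, s.2))
   (fun w t z => g w t.1 (z, t.2)) c B eta e e (ltW e0) eta0 _ hB e0.
- move=> w; rewrite avg_pair; apply: le_trans (hg w); rewrite le_eqVlt.
  apply/orP; left; apply/eqP/eq_avg => x.
  by rewrite avg_swap [RHS]avg_pair.
- apply: le_trans hm; rewrite ler_pM2r//.
  rewrite -exprM; lra.
pose th (s : X * Y * W) := [ffun l => (p (w l) s.1.1, s.1.2)].
(* Now the column [w] joins the instance: for fixed [x], [y], [w] only one bit per cluster remains
   to be found. *)
have [|||z [D hD]] := @refit_step R (X * Y * W)%type Z ('I_N * (W * Y))%type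
    {ffun 'I_m -> 'I_N * Y} z0 r m (Ordinal r0)
    (fun s z => f s.1.1 z s.2 s.1.2) (fun z s => (q z s.1.1, (s.2, s.1.2)))
    (fun z t => h z t.1 t.2) th c' (fun s i => D' s.1 i s.2) eta (4 * eta + 5 * e + e) e eta0 _ _ e0.
- move=> z; rewrite avg_pair avg_pair; apply: le_trans (hh z); rewrite le_eqVlt.
  apply/orP; left; apply/eqP/eq_avg => x.
  by rewrite avg_swap [RHS]avg_pair.
- apply: le_trans hD'; rewrite avg_pair le_eqVlt.
  by apply/orP; left; apply/eqP/eq_avg => s; rewrite avg_swap.
- apply: le_trans hm; rewrite ler_pM2r//.
  rewrite exprMn; lra.
(* Only the classes of [x] are stored; the copies of [y] and [w] inside the types are restored from
   the argument [u]. *)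
apply: (@approximable_type _ _ ({ffun 'I_m -> 'I_N} * {ffun 'I_m -> 'I_N})%type _ _ _
  (fun x => ([ffun l => p (w l) x], [ffun j => q (z j) x]))
  (fun t u => let t1 := [ffun l => (t.1 l, u.2.2)] in
    D t1 [ffun j => (t.2 j, (u.2.1, u.2.2))] (c' t1 u.1))).
  by rewrite card_prod !card_ffun !card_ord expnD.
apply: (@le_trans _ _ (2 * eta + (4 * eta + 5 * e + e) + e)); last by lra.
apply: le_trans hD; rewrite le_eqVlt; apply/orP; left; apply/eqP.
rewrite avg_pair avg_pair; apply: eq_avg => x.
rewrite avg_pair avg_swap avg_pair avg_swap; apply: eq_avg => y.
apply: eq_avg => w'; apply: eq_avg => z' /=.
rewrite (_ : [ffun l => _] = th ((x, y), w')).
  by congr (_ != D _ _ _)%:R; apply/ffunP => j; rewrite !ffunE.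
by apply/ffunP => l; rewrite !ffunE.
Qed.

Fixpoint cube (A : finType) (s : nat) : finType :=
  if s is s'.+1 then (A * cube A s')%type else unit.

Section Slicewise.
Variables (A : finType) (r : nat) (e : R).

(** The clauses are the hypotheses that one use of [approximable_step] consumes: the two families of
    slices, and row structure in the first two of the remaining coordinates. *)
Fixpoint slicewise (s : nat) : (A -> cube A s.+1 -> bool) -> Prop :=
  match s with
  | 0 => fun f => row_structured r e (fun x z => f x (z, tt))
  | s'.+1 => fun f =>
    [/\ forall a, slicewise (fun x u => f x (a, u)),
        forall a, slicewise (fun x u => f x (u.1, (a, u.2))) &
        forall x y, row_structured r e (fun z w => f x (z, (w, y)))]
  end.

Lemma slicewise_approximable (a0 : A) (m s : nat) (f : A -> cube A s.+1 -> bool) :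
  (0 < r)%N -> 0 < e -> 16 * r%:R ^+ 4 / e ^+ 2 <= m%:R ->
  slicewise f -> approximable (r ^ ((m + m) ^ s)) (13 ^+ s * e) f.
Proof.
move=> r0 e0 hm; elim: s f => [|s IH] f.
  move=> [c [B h]]; exists c, (fun i u => B i u.1).
  rewrite expr0 mul1r; apply: le_trans h.
  rewrite le_eqVlt; apply/orP; left; apply/eqP/eq_avg => x.
  rewrite avg_pair; apply: eq_avg => z.
  by rewrite -[RHS](@avg_const _ (cube A 0) tt); apply: eq_avg => -[].
move=> [h1 h2 h3].
have E0 : 0 <= 13 ^+ s * e by rewrite mulr_ge0 ?exprn_ge0// ltW.
have step := @approximable_step A A A (cube A s) a0 a0 r m _ r0
  (fun x z w y => f x (z, (w, y))) _ e E0 e0 hm (fun a => IH _ (h2 a))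
  (fun a => eq_approximable (fun x u => congr1 (fun u => f x (a, u)) (surjective_pairing u)) (IH _ (h1 a))) h3.
have [p [D h]] : approximable ((r ^ (m + m) ^ s) ^ (m + m)) (6 * (13 ^+ s * e) + 7 * e) f.
  by apply: eq_approximable step => x [z [w y]].
rewrite expnSr expnM; exists p, D; apply: le_trans h _.
(* Here 13 is 6 + 7, as [e] is at most [13 ^+ s * e]. *)
rewrite exprS; have : 1 <= 13 ^+ s :> R by rewrite exprn_ege1 ?ler1n.
nra.
Qed.

End Slicewise.
End Recursion.

(** * Functions on a cube *)

Section Coordinates.
Variables (A : finType) (k : nat).
Local Notation point := {ffun 'I_k -> A}.

Definition upd (q : point) (i : 'I_k) (a : A) : point :=
  [ffun j => if j == i then a else q j].

Lemma updE (q : point) i a : upd q i a i = a.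
Proof. by rewrite ffunE eqxx. Qed.

Lemma upd_neq (q : point) i j a : j != i -> upd q i a j = q j.
Proof. by rewrite ffunE => /negbTE ->. Qed.

Lemma upd_id (q : point) i : upd q i (q i) = q.
Proof. by apply/ffunP => j; rewrite ffunE; case: eqP => [->|]. Qed.

Lemma upd_upd (q : point) i a b : upd (upd q i a) i b = upd q i b.
Proof. by apply/ffunP => j; rewrite !ffunE; case: eqP. Qed.

Lemma updC (q : point) i j a b :
  i != j -> upd (upd q i a) j b = upd (upd q j b) i a.
Proof.
move=> ij; apply/ffunP => l; rewrite !ffunE.
by case: (eqVneq l j) => [->|//]; rewrite eq_sym (negbTE ij).
Qed.

Fixpoint place (l : seq 'I_k) : point -> cube A (size l) -> point :=
  match l with
  | [::] => fun q _ => q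
  | i :: l' => fun q u => place (upd q i u.1) u.2
  end.
Arguments place : clear implicits.

Fixpoint coords (l : seq 'I_k) (q : point) : cube A (size l) :=
  match l with
  | [::] => tt
  | i :: l' => (q i, coords l' q)
  end.

Lemma place_upd (l : seq 'I_k) q i a u :
  i \notin l -> place l (upd q i a) u = upd (place l q u) i a.
Proof.
elim: l q u => [//|j l IH] q u /=; rewrite inE negb_or => /andP[ij il].
by rewrite updC// IH.
Qed.

Lemma coords_upd (l : seq 'I_k) q i a :
  i \notin l -> coords l (upd q i a) = coords l q.
Proof.
elim: l => [//|j l IH] /=; rewrite inE negb_or => /andP[ij il].
by rewrite IH// upd_neq// eq_sym.
Qed.

Lemma place_notin (l : seq 'I_k) q u i : i \notin l -> place l q u i = q i.
Proof. by move=> il; rewrite -{1}(upd_id q i) place_upd// updE. Qed.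

Lemma placeK (l : seq 'I_k) q : uniq l -> cancel (place l q) (coords l).
Proof.
elim: l q => [|i l IH] q /=; first by move=> _ [].
by case/andP=> il ul [a u] /=; rewrite IH// place_notin// updE.
Qed.

Lemma place_coords (l : seq 'I_k) (q q' : point) :
  (forall i, i \notin l -> q i = q' i) -> place l q (coords l q') = q'.
Proof.
elim: l q => [|i l IH] q /= h; first by apply/ffunP => i; exact: h.
apply: IH => j jl; rewrite ffunE; case: eqP => [->//|/eqP ji].
by apply: h; rewrite inE negb_or ji.
Qed.

Variable R : realFieldType.

(** A coordinate fixed by a slice is moved into the base point [q], since updates at distinct
    coordinates commute. The hypothesis on pairs of coordinates then gives every clause. *)
Lemma slicewise_place (r : nat) (e : R) (F : point -> bool) :
  (forall q i j, i != j ->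
     row_structured r e (fun x y => F (upd (upd q i x) j y))) ->
  forall l i j q, uniq [:: i, j & l] ->
  slicewise r e (fun x (u : cube A (size l).+1) => F (place (j :: l) (upd q i x) u)).
Proof.
move=> hF; elim=> [|j2 l IH] i j q /=.
  by rewrite inE !andbT => ij; exact: hF.
rewrite !inE !negb_or -!andbA => /and5P[ij ij2 il jj2 /and3P[jl j2l ul]].
split.
- move=> a; rewrite (_ : (fun x u => _) =
    (fun x (u : cube A (size l).+1) => F (place (j2 :: l) (upd (upd q j a) i x) u))).
    by apply: IH => /=; rewrite inE negb_or ij2 il j2l.
  by apply/funext => x; apply/funext => u; rewrite /= (updC _ _ _ ij).
- move=> a; rewrite (_ : (fun x u => _) =
    (fun x (u : cube A (size l).+1) => F (place (j :: l) (upd (upd q j2 a) i x) u))).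
    by apply: IH => /=; rewrite inE negb_or ij il jl.
  apply/funext => x; apply/funext => u /=.
  by rewrite (updC _ _ _ jj2) (updC _ _ _ ij2).
- move=> x y; rewrite (_ : (fun z w => _) =
    (fun z w => F (upd (upd (place l (upd q i x) y) j z) j2 w))); first exact: hF.
  by apply/funext => z; apply/funext => w; rewrite !place_upd.
Qed.

Lemma avg_bij (S T : finType) (g : S -> T) (F : T -> R) :
  bijective g -> avg (F \o g) = avg F.
Proof.
move=> bg; rewrite /avg (bij_eq_card bg); congr (_ / _).
by rewrite [RHS](reindex g)//=; exact: onW_bij.
Qed.

(** A point is split into its coordinate [i] and the cube of the [k - 1] others, whose first one is
    the base of the induction; hence [k - 2] steps. [D] reads a point only through the others, so it
    ignores coordinate [i]. *)
Lemma coordinate_approx (a0 : A) (r m : nat) (e : R) (F : point -> bool)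
    (i : 'I_k) :
  (1 < k)%N -> (0 < r)%N -> 0 < e -> 16 * r%:R ^+ 4 / e ^+ 2 <= m%:R ->
  (forall q i j, i != j ->
     row_structured r e (fun x y => F (upd (upd q i x) j y))) ->
  exists (p : A -> 'I_(r ^ ((m + m) ^ (k - 2)))) (D : _ -> point -> bool),
    (forall t q a, D t (upd q i a) = D t q) /\
    avg (fun q => (F q != D (p (q i)) q)%:R) <= 13 ^+ (k - 2) * e.
Proof.
move=> k1 r0 e0 hm hF.
pose l := rem i (enum 'I_k).
have ul : uniq (i :: l).
  by rewrite /= mem_rem_uniq ?enum_uniq// inE eqxx rem_uniq ?enum_uniq.
have lP j : j != i -> j \in l by rewrite mem_rem_uniq ?enum_uniq// inE mem_enum => ->.
have sl : size l = k.-1 by rewrite size_rem ?mem_enum// size_enum_ord.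
case: l ul lP sl => [|j l]; first by move=> _ _ /= sl; lia.
move=> ul lP sl; have {}sl : size l = (k - 2)%N by move: sl => /= sl; lia.
pose q0 : point := [ffun => a0].
have := slicewise_approximable a0 r0 e0 hm (slicewise_place hF q0 ul).
rewrite -sl => -[p [D h]]; exists p, (fun t q => D t (coords (j :: l) q)).
have [ijl ujl] : i \notin j :: l /\ uniq (j :: l) by move: ul; rewrite cons_uniq => /andP.
split=> [t q a|]; first by rewrite coords_upd.
apply: le_trans h; rewrite le_eqVlt; apply/orP; left; apply/eqP.
pose g (xu : A * cube A (size l).+1) := place (j :: l) (upd q0 i xu.1) xu.2.
rewrite -(@avg_bij _ _ g).
  rewrite avg_pair; apply: eq_avg => x; apply: eq_avg => u; rewrite /g [in LHS]/comp.
  by rewrite [X in D _ X]placeK// place_notin// updE.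
exists (fun q : point => (q i, coords (j :: l) q)) => [[x u]|q].
  by rewrite /g [X in (_, X)]placeK// place_notin// updE.
rewrite /g place_coords// => i' hi'; rewrite ffunE; case: eqP => [->//|/eqP /lP].
by rewrite (negbTE hi').
Qed.

(** * Conditional averages along one coordinate *)

Section BlockAverage.
Variables (K : nat) (b : 'I_k -> A -> 'I_K).

(** The conditional expectation of [H] when coordinate [i] is known only up to its block. The
    denominator is positive because [q i] lies in its own block. *)
Definition block_avg (i : 'I_k) (H : point -> R) (q : point) : R :=
  (\sum_(a | b i a == b i (q i)) H (upd q i a)) /
  #|[pred a | b i a == b i (q i)]|%:R.

(** Double counting: the involution exchanging [q i] and [a] preserves the pairs [(q, a)] with both
    in the same block. *)
Lemma sum_block_avg (i : 'I_k) (H : point -> R) :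
  \sum_q block_avg i H q = \sum_q H q.
Proof.
pose w (x : A) : R := #|[pred a | b i a == b i x]|%:R^-1.
transitivity (\sum_(qa : point * A | b i qa.2 == b i (qa.1 i))
                H (upd qa.1 i qa.2) * w (qa.1 i)).
  rewrite -(pair_big_dep xpredT (fun (q : point) a => b i a == b i (q i))
    (fun (q : point) a => H (upd q i a) * w (q i))) /=.
  by apply: eq_bigr => q _; rewrite /block_avg mulr_suml.
pose h (qa : point * A) := (upd qa.1 i qa.2, qa.1 i).
have hK : involutive h by case=> q a; rewrite /h /= updE upd_upd upd_id.
rewrite (reindex h) /=; last by apply: onW_bij; exists h.
transitivity (\sum_(qa : point * A | b i qa.2 == b i (qa.1 i)) H qa.1 * w (qa.1 i)).
  apply: eq_big => [[q a]|[q a]] /=; rewrite updE 1?eq_sym// => /eqP bq.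
  by rewrite upd_upd upd_id /w; congr (_ * _^-1); congr (_%:R); apply: eq_card => x; rewrite !inE bq.
rewrite -(pair_big_dep xpredT (fun (q : point) a => b i a == b i (q i)) (fun q a => H q * w (q i))) /=.
apply: eq_bigr => q _; rewrite sumr_const -[_ *+ _]mulr_natr -mulrA /w mulVf ?mulr1//.
by rewrite pnatr_eq0 -lt0n; apply/card_gt0P; exists (q i); rewrite inE.
Qed.

Lemma ler_norm_block_avg (i : 'I_k) (H : point -> R) q :
  `|block_avg i H q| <= block_avg i (fun q => `|H q|) q.
Proof.
rewrite /block_avg normrM normfV normr_nat ler_wpM2r ?invr_ge0 ?ler0n//.
exact: ler_norm_sum.
Qed.

Lemma avg_block_avg (i : 'I_k) (H : point -> R) :
  avg (fun q => `|block_avg i H q|) <= avg (fun q => `|H q|).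
Proof.
rewrite -[leRHS](_ : avg (block_avg i (fun q => `|H q|)) = _).
  by apply: ler_avg => q; exact: ler_norm_block_avg.
by rewrite /avg sum_block_avg.
Qed.

Lemma block_avgB (i : 'I_k) (G H : point -> R) q :
  block_avg i (fun q => G q - H q) q = block_avg i G q - block_avg i H q.
Proof. by rewrite /block_avg sumrB mulrBl. Qed.

Lemma block_avg_id (i : 'I_k) (H : point -> R) (q : point) :
  (forall a, b i a = b i (q i) -> H (upd q i a) = H q) ->
  block_avg i H q = H q.
Proof.
move=> hH; rewrite /block_avg (eq_bigr (fun=> H q)); last by move=> a /eqP /hH.
rewrite sumr_const -[_ *+ _]mulr_natr mulfK// pnatr_eq0 -lt0n.
by apply/card_gt0P; exists (q i); exact: eqxx.
Qed.

(** [Phi] arises from [F] by averaging over the blocks of one coordinate after another; after the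
    coordinates in [l], it depends on these only through their blocks. *)
Lemma block_constant_approx (F : point -> R) (eta : R) :
  (forall i, exists G : point -> R,
     (forall (q : point) a, b i a = b i (q i) -> G (upd q i a) = G q) /\
     avg (fun q => `|F q - G q|) <= eta) ->
  exists Phi : point -> R,
    (forall q q' : point, (forall i, b i (q i) = b i (q' i)) -> Phi q = Phi q') /\
    avg (fun q => `|F q - Phi q|) <= 2 * k%:R * eta.
Proof.
move=> hF.
have : forall l : seq 'I_k, exists Phi : point -> R,
    (forall q q' : point, (forall i, i \in l -> b i (q i) = b i (q' i)) ->
       (forall i, i \notin l -> q i = q' i) -> Phi q = Phi q') /\
    avg (fun q => `|F q - Phi q|) <= 2 * (size l)%:R * eta.
  elim=> [|i l [Phi [hPhi le]]].
    exists F; split=> [q q' _ qq'|]; first by congr F; apply/ffunP => i; exact: qq'.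
    rewrite mulr0 mul0r /avg big1 ?mul0r// => q _; by rewrite subrr normr0.
  exists (block_avg i Phi); split.
    move=> q q' h1 h2; rewrite /block_avg h1 ?mem_head//; congr (_ / _).
    apply: eq_bigr => a _; apply: hPhi => j jl; rewrite !ffunE; case: eqP => [//|/eqP ji].
      by apply: h1; rewrite inE jl orbT.
    by apply: h2; rewrite inE negb_or ji.
  have [G [hG leG]] := hF i.
  (* Averaging fixes [G] and contracts the L^1 norm, so the first two terms cost [eta] each and the
     last is at most the error before this coordinate. *)
  apply: (@le_trans _ _ (avg (fun q => `|F q - G q| + `|block_avg i (fun q => G q - F q) q| +
      `|block_avg i (fun q => F q - Phi q) q|))).
    apply: ler_avg => q; rewrite !block_avgB (block_avg_id (hG q)).
    rewrite -[X in `|X|](_ : F q - G q + (G q - block_avg i F q) + (block_avg i F q - block_avg i Phi q) = _); last by ring.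
    by apply: le_trans (ler_normD _ _) _; rewrite lerD2r ler_normD.
  rewrite !avgD; apply: le_trans (lerD (lerD leG (avg_block_avg _ _)) (avg_block_avg _ _)) _.
  have : avg (fun q => `|G q - F q|) <= eta by under eq_avg do rewrite distrC.
  by move: le => /=; rewrite -natr1; lra.
move=> /(_ (enum 'I_k)) [Phi [h1 h2]]; exists Phi; split.
  by move=> q q' qq'; apply: h1 => i //; rewrite mem_enum.
by move: h2; rewrite size_enum_ord.
Qed.

End BlockAverage.
End Coordinates.

(** * Cutting a set into nearly equal blocks *)

Section EquitableBlocks.
Local Open Scope nat_scope.

Lemma count_iota_between (n a c : nat) :
  a <= c <= n -> count (fun y => a <= y < c) (iota 0 n) = c - a.
Proof.
move=> /andP[ac cn].
have -> : iota 0 n = iota 0 a ++ iota a (c - a) ++ iota c (n - c).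
  by rewrite -[in iota c _](subnKC ac) -iotaD -iotaD; congr iota; lia.
rewrite !count_cat.
rewrite (eq_in_count (a2 := pred0)) => [|y]; last by rewrite mem_iota /=; lia.
rewrite count_pred0 (eq_in_count (a2 := predT)) => [|y]; last by rewrite mem_iota /=; lia.
rewrite count_predT size_iota (eq_in_count (a2 := pred0)) => [|y]; last by rewrite mem_iota /=; lia.
by rewrite count_pred0 addn0.
Qed.

Lemma count_index (T : eqType) (s : seq T) (P : pred nat) :
  uniq s -> count (fun x => P (index x s)) s = count P (iota 0 (size s)).
Proof.
move=> us; rewrite -(count_map (index^~ s)); congr count.
case: s us => [//|x0 s'] us; set s := x0 :: s' in us *.
apply: (@eq_from_nth _ 0) => [|i]; rewrite size_map ?size_iota// => si.
by rewrite (nth_map x0)// nth_iota// index_uniq.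
Qed.

(* Sort the points by class and cut into consecutive runs of nearly equal
   length: two mixed runs cannot start in the same class, so at most [N] runs
   are mixed. *)
Lemma equitable_refinement (A : finType) (N K : nat) (p : A -> 'I_N) :
  0 < K <= #|A| ->
  exists (b : A -> 'I_K) (e : 'I_K -> 'I_N),
    (forall j j', #|[set x | b x == j]| <= #|[set x | b x == j']|.+1) /\
    #|[set x | e (b x) != p x]| <= N * (#|A| %/ K).+1.
Proof.
move=> /andP[K0 KA]; set n := #|A|.
have n0 : 0 < n by exact: leq_trans KA.
pose s := sort (fun x y => p x <= p y) (enum A).
have us : uniq s by rewrite sort_uniq enum_uniq.
have ss : size s = n by rewrite size_sort -cardE.
have ms x : x \in s by rewrite mem_sort mem_enum.
pose rk x := index x s.
have rkn x : rk x < n by rewrite -ss index_mem.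
have bP x : rk x * K %/ n < K by rewrite ltn_divLR// mulnC ltn_pmul2l.
(* This is [j * n / K] rounded up, the rank at which run [j] starts. *)
pose lo j := (j * n + K.-1) %/ K.
pose b x := Ordinal (bP x).
have lo_le j y : (lo j <= y) = (j * n <= y * K).
  rewrite -ltnS ltn_divLR//; apply/idP/idP; lia.
have b_eq x (j : 'I_K) : (b x == j) = (lo j <= rk x < lo j.+1).
  rewrite -val_eqE /= eqn_leq ltnNge !lo_le leq_divRL// -ltnNge.
  by rewrite -ltnS ltn_divLR// andbC.
have lo_le_n (j : 'I_K) : lo j.+1 <= n by rewrite lo_le mulnC leq_pmul2l.
have lo_step j : lo j + n %/ K <= lo j.+1 <= lo j + (n %/ K).+1.
  have -> : lo j.+1 = n %/ K + (n %% K + (j * n + K.-1)) %/ K.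
    by rewrite -divnMDl// /lo; congr (_ %/ _); have := divn_eq n K; lia.
  rewrite /lo.
  have h1 : (j * n + K.-1) %/ K <= (n %% K + (j * n + K.-1)) %/ K by apply: leq_div2r; lia.
  have h2 : (n %% K + (j * n + K.-1)) %/ K <= ((j * n + K.-1) %/ K).+1.
    rewrite -ltnS ltn_divLR// !mulSn.
    have := ltn_pmod n K0; have := divn_eq (j * n + K.-1) K; have := ltn_pmod (j * n + K.-1) K0.
    lia.
  lia.
have lo_mono i j : i <= j -> lo i <= lo j by move=> ij; apply: leq_div2r; rewrite leq_add2r leq_mul2r ij orbT.
have q1 : 0 < n %/ K by rewrite divn_gt0.
move: q1 lo_step; move: (n %/ K) => q q1 lo_step; clearbody lo.
have card_b (j : 'I_K) : #|[set x | b x == j]| = lo j.+1 - lo j.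
  rewrite cardsE cardE size_filter -enumT.
  have /permP <- : perm_eq s (enum A) by rewrite perm_sort.
  rewrite (eq_count (a2 := fun x => lo j <= rk x < lo j.+1)); last by move=> x; exact: b_eq.
  rewrite (@count_index _ s (fun y => lo j <= y < lo j.+1))// ss count_iota_between//.
  by rewrite lo_le_n andbT; have := lo_step j; lia.
have [x0 _] : exists x0 : A, true by case/card_gt0P: n0 => x0; exists x0.
(* A run is labelled by the class of its first point. *)
pose e (j : 'I_K) := p (nth x0 s (lo j)).
have lo_n (j : 'I_K) : lo j < n by have := lo_step j; have := lo_le_n j; lia.
have p_mono y z : y <= z < n -> p (nth x0 s y) <= p (nth x0 s z).
  move=> /andP[yz zn].
  apply: (sorted_leq_nth (leT := fun x y => p x <= p y)) => //.
  - by move=> ? ? ?; exact: leq_trans.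
  - by apply: sort_sorted => ? ?; exact: leq_total.
  - by rewrite inE ss; exact: leq_ltn_trans zn.
  - by rewrite inE ss.
exists b, e; split=> [j j'|].
  by rewrite !card_b; have := lo_step j; have := lo_step j'; lia.
pose J := [set j : 'I_K | [exists x, (b x == j) && (e j != p x)]].
have JN : #|J| <= N.
  rewrite -[X in _ <= X]card_ord -(@card_in_imset _ _ e) ?max_card//.
  (* If a later run starts in the class where run [j] starts, sortedness puts all of run [j] in that
     class, so it is not mixed. *)
  suff e_inj (j j' : 'I_K) : j \in J -> e j = e j' -> ~ j < j'.
    move=> j j' jJ j'J ejj'; apply/val_inj.
    case: (ltngtP j j') => // [/(e_inj _ _ jJ ejj')//|/(e_inj _ _ j'J (esym ejj'))//].
  rewrite inE => /existsP[x /andP[]]; rewrite b_eq => /andP[h1 h2] /eqP ep ejj' jj'.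
  apply: ep; apply/val_inj/eqP; rewrite eqn_leq -(nth_index x0 (ms x)) -/(rk x).
  apply/andP; split; first by apply: p_mono; rewrite h1 rkn.
  rewrite ejj'; apply: p_mono; rewrite lo_n andbT.
  exact: leq_trans (ltnW h2) (lo_mono _ _ jj').
apply: leq_trans (_ : _ <= #|\bigcup_(j in J) [set x | b x == j]|) _.
  apply/subset_leq_card/subsetP => x; rewrite inE => ex.
  apply/bigcupP; exists (b x); rewrite !inE//.
  by apply/existsP; exists x; rewrite eqxx.
apply: leq_trans (_ : _ <= \sum_(j in J) #|[set x | b x == j]|) _.
  elim/big_ind2: _ => [|X1 n1 X2 n2 h1 h2|//]; first by rewrite cards0.
  by apply: leq_trans (leq_card_setU _ _) (leq_add h1 h2).
apply: leq_trans (_ : _ <= \sum_(j in J) (q).+1) _.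
  by apply: leq_sum => j _; rewrite card_b; have := lo_step j; lia.
by rewrite sum_nat_const leq_mul2r JN orbT.
Qed.

End EquitableBlocks.

(** * Regularity for a function on a cube *)

Section CubeRegularity.
Variable R : realFieldType.

(** The case of [sum_block_avg] in which a coordinate has a single block. *)
Lemma avg_marginal (A : finType) (k : nat) (i : 'I_k) (a0 : A) (phi : A -> R) :
  avg (fun q : {ffun 'I_k -> A} => phi (q i)) = avg phi.
Proof.
rewrite -[RHS](@avg_const _ {ffun 'I_k -> A} [ffun => a0]) /avg; congr (_ / _).
rewrite -(sum_block_avg (fun _ _ => ord0 : 'I_1) i); apply: eq_bigr => q _.
rewrite /block_avg; congr (_ / _%:R).
by apply: eq_big => a; rewrite ?eqxx// ffunE eqxx.
Qed.

Lemma indicator_dist (a b : bool) : `|a%:R - b%:R| = (a != b)%:R :> R.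
Proof. by case: a; case: b; rewrite ?subrr ?subr0 ?sub0r ?normrN ?normr1 ?normr0. Qed.

Lemma cube_regular (n k r m K0 : nat) (e : R) (F : {ffun 'I_k -> 'I_n} -> bool) :
  (1 < k)%N -> (0 < n)%N -> (0 < r)%N -> 0 < e ->
  16 * r%:R ^+ 4 / e ^+ 2 <= m%:R ->
  2 * (r ^ ((m + m) ^ (k - 2)))%:R / e <= K0%:R ->
  (forall q i j, i != j ->
     row_structured r e (fun x y => F (upd (upd q i x) j y))) ->
  exists (K : nat) (b : 'I_k -> 'I_n -> 'I_K) (Phi : {ffun 'I_k -> 'I_n} -> R),
    [/\ (K <= K0)%N,
        forall i j j', (#|[set x | b i x == j]| <= #|[set x | b i x == j']|.+1)%N,
        forall q q' : {ffun 'I_k -> 'I_n},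
          (forall i, b i (q i) = b i (q' i)) -> Phi q = Phi q' &
        avg (fun q => `|(F q)%:R - Phi q|) <= 2 * k%:R * ((13 ^+ (k - 2) + 1) * e)].
Proof.
move=> k1 n0 r0 e0 hm hK hF.
(* With few points singletons and [Phi = F] are exact; otherwise there are enough points to cut into
   [K0] nonempty runs. *)
case: (leqP n K0) => [nK|Kn].
  exists n, (fun _ => id), (fun q => (F q)%:R); split=> //.
  - move=> i j j'; rewrite [leqRHS](_ : _ = 2); last first.
      by rewrite (_ : [set x | x == j'] = [set j']) ?cards1//; apply/setP => x; rewrite !inE.
    by rewrite (_ : [set x | x == j] = [set j]) ?cards1//; apply/setP => x; rewrite !inE.
  - by move=> q q' qq'; congr (F _)%:R; apply/ffunP.
  - rewrite /avg big1 ?mul0r; last by move=> q _; rewrite subrr normr0.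
    by rewrite !mulr_ge0 ?ler0n// ?ltW// addr_gt0 ?exprn_gt0.
set N := (r ^ _)%N in hK.
have N0 : (0 < N)%N by rewrite expn_gt0 r0.
have K00 : (0 < K0)%N.
  by rewrite -(ltr0n R); apply: lt_le_trans hK; rewrite divr_gt0 ?mulr_gt0 ?ltr0n.
have a0 : 'I_n by exact: Ordinal n0.
have hpD := fun i => coordinate_approx a0 i k1 r0 e0 hm hF.
have [p hp] := choice hpD.
have heq i : exists b : ('I_n -> 'I_K0) * ('I_K0 -> 'I_N),
    (forall j j', #|[set x | b.1 x == j]| <= #|[set x | b.1 x == j']|.+1)%N /\
    (#|[set x | b.2 (b.1 x) != p i x]| <= N * (n %/ K0).+1)%N.
  have [|b [ee hb]] := @equitable_refinement 'I_n N K0 (p i).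
    by rewrite K00 card_ord ltnW.
  by exists (b, ee); rewrite card_ord in hb.
have [be hbe] := choice heq.
pose b i := (be i).1.
have [i|Phi [h1 h2]] := @block_constant_approx _ _ R K0 b (fun q => (F q)%:R) ((13 ^+ (k - 2) + 1) * e).
  have [D [hD1 hD2]] := hp i; have [hb1 hb2] := hbe i.
  exists (fun q : {ffun 'I_k -> 'I_n} => (D ((be i).2 (b i (q i))) q)%:R); split.
    by move=> q a hba; rewrite hD1 updE hba.
  apply: (@le_trans _ _ (avg (fun q : {ffun 'I_k -> 'I_n} => (F q != D (p i (q i)) q)%:R) +
      avg (fun q : {ffun 'I_k -> 'I_n} => ((be i).2 (b i (q i)) != p i (q i))%:R))).
    rewrite -avgD; apply: ler_avg => q; rewrite indicator_dist.
    case: (eqVneq ((be i).2 (b i (q i))) (p i (q i))) => [->|_] /=; first by rewrite addr0.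
    by apply: (@le_trans _ _ 1); rewrite ?lerDr// lern1 leq_b1.
  rewrite mulrDl mul1r lerD//.
  rewrite (@avg_marginal _ _ i a0 (fun a => ((be i).2 (b i a) != p i a)%:R)).
  rewrite /avg -natr_sum ler_pdivrMr ?ltr0n ?card_ord//.
  rewrite (_ : \sum_t _ = #|[set x | (be i).2 (b i x) != p i x]|); last first.
    by rewrite -sum1dep_card [RHS]big_mkcond; apply: eq_bigr => x _; case: (_ != _).
  apply: le_trans (_ : _ <= (N * (n %/ K0).+1)%:R) _; first by rewrite ler_nat.
  (* As [K0 < n], the [N] mixed runs hold at most [2 * N * n / K0] points, which is at most [e * n]
     by the choice of [K0]. *)
  have h3 : (K0 * (n %/ K0).+1 <= 2 * n)%N.
    by rewrite mulnS mulnC; have := leq_trunc_div n K0; lia.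
  have h4 : K0%:R * (n %/ K0).+1%:R <= 2 * n%:R :> R by rewrite -!natrM ler_nat.
  move: hK; rewrite ler_pdivrMr// => hK.
  rewrite -(ler_pM2l (_ : 0 < K0%:R :> R)) ?ltr0n// natrM.
  have h5 := ler_wpM2l (ler0n R N) h4.
  have h6 := ler_wpM2r (ler0n R n) hK.
  by nra.
exists K0, b, Phi; split=> // i j j'.
by have [] := hbe i.
Qed.

(** Rows are grouped by their block in [PX] and each cell is rounded to a constant. Homogeneous
    cells contribute a [g] fraction of their size and the other cells have total size at most a [g]
    fraction of everything, whence [2 * g]. *)
Lemma bip_row_structured (R' : realType) (V : finType) (n : nat) (E : rel V) (g r : R')
    (X Y : {set V}) (phi psi : 'I_n -> V) :
  injective phi -> injective psi -> X = [set phi x | x : 'I_n] ->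
  Y = [set psi y | y : 'I_n] -> (0 < n)%N -> 0 <= g ->
  has_bip_homogeneous_partition E g r X Y ->
  row_structured (Num.truncn r) (2 * g) (fun x y => E (phi x) (psi y)).
Proof.
move=> phi_inj psi_inj XE YE n0 g0 [PX [PY [[pX pY hsum] cX _]]].
have rPX : (#|PX| <= Num.truncn r)%N by rewrite truncn_ge_nat// (le_trans _ cX).
have inX x : pblock PX (phi x) \in PX.
  by rewrite pblock_mem// (cover_partition pX) XE imset_f.
have ltc x : (index (pblock PX (phi x)) (enum PX) < Num.truncn r)%N.
  by apply: leq_trans rPX; rewrite cardE index_mem mem_enum.
pose B (X' Y' : {set V}) := 1 - g <= bip_density R' E X' Y'.
(* The default [set0] stands for indices beyond [#|PX|], which no row receives. *)
exists (fun x => Ordinal (ltc x)), (fun a y => B (nth set0 (enum PX) a) (pblock PY (psi y))).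
have cellbound (X' Y' : {set V}) : X' \in PX -> Y' \in PY ->
   \sum_(u in X') \sum_(v in Y') (E u v != B X' Y')%:R <=
   g * (#|X'|%:R * #|Y'|%:R) +
   (if ~~ bip_homogeneous E g X' Y' then #|X'|%:R * #|Y'|%:R else 0).
  move=> X'P Y'P.
  have X'0 : 0 < #|X'|%:R :> R'.
    by rewrite ltr0n card_gt0; apply: contraTneq X'P => ->; case/and3P: pX.
  have Y'0 : 0 < #|Y'|%:R :> R'.
    by rewrite ltr0n card_gt0; apply: contraTneq Y'P => ->; case/and3P: pY.
  have S0 : \sum_(u in X') \sum_(v in Y') 1 = #|X'|%:R * #|Y'|%:R :> R'.
    by rewrite sumr_const sumr_const mulr_natl.
  have S1 : \sum_(u in X') \sum_(v in Y') (E u v)%:R = bip_density R' E X' Y' * (#|X'|%:R * #|Y'|%:R).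
    rewrite /bip_density mulfVK ?gt_eqF ?mulr_gt0//.
    rewrite pair_big /= -natr_sum -sum1dep_card; congr (_%:R).
    rewrite [LHS]big_mkcond [RHS]big_mkcond; apply: eq_bigr => -[u v] _ /=.
    by rewrite !inE /=; case: (u \in X'); case: (v \in Y'); case: (E u v).
  have S2 : \sum_(u in X') \sum_(v in Y') (~~ E u v)%:R =
      (1 - bip_density R' E X' Y') * (#|X'|%:R * #|Y'|%:R).
    rewrite mulrBl mul1r -S1 -S0 -sumrB; apply: eq_bigr => u _.
    by rewrite -sumrB; apply: eq_bigr => v _; case: (E u v); rewrite ?subrr ?subr0.
  have XY0 : 0 < #|X'|%:R * #|Y'|%:R :> R' by exact: mulr_gt0.
  rewrite /B; case: (boolP (1 - g <= _)) => hd.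
    under eq_bigr do under eq_bigr do rewrite eqb_id.
    rewrite S2; apply: (@le_trans _ _ (g * (#|X'|%:R * #|Y'|%:R))).
      by rewrite ler_pM2r//; lra.
    by rewrite lerDl; case: ifP => // _; exact: ltW.
  under eq_bigr do under eq_bigr do rewrite eqbF_neg negbK.
  case: (boolP (bip_homogeneous E g X' Y')) => /= [/orP[/andP[_ d1]|]|_].
  - by rewrite addr0 S1 ler_pM2r.
  - by rewrite (negbTE hd).
  - apply: (@le_trans _ _ (#|X'|%:R * #|Y'|%:R)); last by rewrite lerDr mulr_ge0// ltW.
    by rewrite -S0; apply: ler_sum => u _; apply: ler_sum => v _; rewrite lern1 leq_b1.
have cardX : #|X| = n by rewrite XE card_imset// card_ord.
have cardY : #|Y| = n by rewrite YE card_imset// card_ord.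
have n0' : 0 < n%:R :> R' by rewrite ltr0n.
rewrite /avg -mulr_suml card_ord -mulrA -invfM ler_pdivrMr ?mulr_gt0//.
pose err u v := (E u v != B (pblock PX u) (pblock PY v))%:R : R'.
apply: (@le_trans _ _ (\sum_(u in X) \sum_(v in Y) err u v)).
  rewrite XE big_imset /=; last by move=> ? ? _ _; exact: phi_inj.
  apply: ler_sum => x _; rewrite YE big_imset /=; last by move=> ? ? _ _; exact: psi_inj.
  by apply: ler_sum => y _; rewrite /err nth_index// mem_enum.
have -> : \sum_(u in X) \sum_(v in Y) err u v =
    \sum_(X' in PX) \sum_(Y' in PY) \sum_(u in X') \sum_(v in Y') (E u v != B X' Y')%:R.
  rewrite (set_partition_big _ pX); apply: eq_bigr => X' X'P.
  rewrite [RHS]exchange_big /=; apply: eq_bigr => u uX'.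
  rewrite (set_partition_big _ pY); apply: eq_bigr => Y' Y'P; apply: eq_bigr => v vY'.
  by rewrite /err (def_pblock _ X'P uX') ?(def_pblock _ Y'P vY')//; [case/and3P: pY|case/and3P: pX].
apply: (@le_trans _ _ (\sum_(X' in PX) \sum_(Y' in PY) (g * (#|X'|%:R * #|Y'|%:R) +
   (if ~~ bip_homogeneous E g X' Y' then #|X'|%:R * #|Y'|%:R else 0)))).
  by apply: ler_sum => X' X'P; apply: ler_sum => Y' Y'P; exact: cellbound.
have S3 : \sum_(X' in PX) \sum_(Y' in PY) (#|X'|%:R * #|Y'|%:R) = n%:R * n%:R :> R'.
  under eq_bigr do rewrite -mulr_sumr -natr_sum -(card_partition pY).
  by rewrite -mulr_suml -natr_sum -(card_partition pX) cardX cardY.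
under eq_bigr do rewrite big_split /= -mulr_sumr.
rewrite big_split /= -mulr_sumr S3.
under [X in _ + X <= _]eq_bigr do rewrite -big_mkcondr.
by move: hsum; rewrite cardX cardY; lra.
Qed.

End CubeRegularity.

(** * Hypergraphs *)

Section Transfer.
Variables (R : realType) (k : nat) (H : kpartite_kgraph k) (n : nat).
Variable phi : 'I_k -> 'I_n -> vert H.
Hypothesis phi_inj : forall i, injective (phi i).
Hypothesis partE : forall i, part H i = [set phi i x | x : 'I_n].
Local Notation point := {ffun 'I_k -> 'I_n}.

Lemma part_inj v i j : v \in part H i -> v \in part H j -> i = j.
Proof.
move=> vi vj; apply/eqP/negPn/negP => /(part_disjoint H) /disjointFr /(_ vi).
by rewrite vj.
Qed.

Lemma phi_part i x : phi i x \in part H i.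
Proof. by rewrite partE imset_f. Qed.

Definition point_set (q : point) : {set vert H} := [set phi i (q i) | i : 'I_k].

Lemma point_set_part q i v :
  v \in point_set q -> v \in part H i -> v = phi i (q i).
Proof.
by move=> /imsetP[j _ ->] vi; rewrite (part_inj vi (phi_part j _)).
Qed.

Lemma point_set_cap q i (X : {set vert H}) : X \subset part H i ->
  (#|point_set q :&: X| == 1)%N = (phi i (q i) \in X).
Proof.
move=> /subsetP XA; case: (boolP (_ \in X)) => [qX|qX].
  rewrite (_ : _ :&: _ = [set phi i (q i)]) ?cards1//; apply/setP => v.
  rewrite !inE; apply/andP/eqP => [[vq vX]|->]; first exact: point_set_part (XA _ vX).
  by rewrite imset_f.
rewrite (_ : _ :&: _ = set0) ?cards0//; apply/setP => v; rewrite !inE.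
apply/negP => /andP[vq vX]; move: qX.
by rewrite -(point_set_part vq (XA _ vX)) vX.
Qed.

Lemma point_set_inj : injective point_set.
Proof.
move=> q q' qq'; apply/ffunP => i; apply: (@phi_inj i).
by apply: point_set_part (phi_part i _); rewrite -qq' imset_f.
Qed.

(** The edge picks one vertex in each part and, the parts covering everything, has no other
    vertex. *)
Lemma edge_is_point_set e : e \in edges H -> exists q, e = point_set q.
Proof.
move=> eE.
have hq i : exists x : 'I_n, e :&: part H i = [set phi i x].
  have /eqP/cards1P[v ev] := edge_transversal eE i.
  have : v \in e :&: part H i by rewrite ev set11.
  by rewrite inE partE => /andP[_ /imsetP[x _ vx]]; exists x; rewrite -partE ev vx.
have [q eq] := choice hq.
have in_e i v : v \in part H i -> (v \in e) = (v == phi i (q i)).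
  by move=> vi; rewrite -in_set1 -eq inE vi andbT.
exists (finfun q); apply/setP => v; apply/idP/imsetP => [ve|[i _ ->]].
  have : v \in \bigcup_i part H i by rewrite part_cover inE.
  by move=> /bigcupP[i _ vi]; exists i; rewrite // ffunE; apply/eqP; rewrite -(in_e i).
by rewrite ffunE (in_e i) ?phi_part.
Qed.

Lemma card_cell (X : 'I_k -> {set vert H}) : (forall i, X i \subset part H i) ->
  #|[set q : point | [forall i, phi i (q i) \in X i]]| = (\prod_i #|X i|)%N.
Proof.
move=> XA; have cX i : #|X i| = (\sum_(x | phi i x \in X i) 1)%N.
  rewrite sum1dep_card -(card_imset _ (@phi_inj i)); apply: eq_card => v.
  apply/idP/imsetP => [vX|[x]]; last by rewrite inE => ? ->.
  have := subsetP (XA i) v vX; rewrite partE => /imsetP[x _ vx].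
  by exists x; rewrite // inE -vx.
rewrite (eq_bigr _ (fun i _ => cX i)) bigA_distr_big_dep /=.
rewrite -sum1dep_card; apply: eq_big => [q|q _]; last by rewrite big1.
by apply/forallP/familyP => h i; have := h i.
Qed.

Lemma density_point_set (X : 'I_k -> {set vert H}) :
  (forall i, X i \subset part H i) ->
  density R X = #|[set q | (point_set q \in edges H) &&
                           [forall i, phi i (q i) \in X i]]|%:R / \prod_i #|X i|%:R.
Proof.
move=> XA; rewrite /density; congr (_%:R / _).
rewrite -(card_imset _ point_set_inj); apply: eq_card => e.
rewrite inE; apply/andP/imsetP => [[eE /forallP eX]|[q]].
  have [q eq] := edge_is_point_set eE; exists q => //.
  rewrite inE -eq eE; apply/forallP => i.
  by rewrite -(point_set_cap q (XA i)) -eq.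
rewrite inE => /andP[qE /forallP qX] ->; split=> //.
by apply/forallP => i; rewrite (point_set_cap q (XA i)).
Qed.

Section Blocks.
Variables (K : nat) (b : 'I_k -> 'I_n -> 'I_K).

(** Indexing by a point of the block instead of its number in ['I_K] keeps blocks nonempty, as
    [partition] demands. *)
Definition block (i : 'I_k) (x : 'I_n) : {set vert H} :=
  phi i @: [set y | b i y == b i x].

Definition blocks (i : 'I_k) : {set {set vert H}} := [set block i x | x : 'I_n].

Lemma mem_block i x y : (phi i y \in block i x) = (b i y == b i x).
Proof. by rewrite mem_imset// inE. Qed.

Lemma block_sub i x : block i x \subset part H i.
Proof. by apply/subsetP => v /imsetP[y _ ->]; exact: phi_part. Qed.

Lemma blocks_partition i : partition (blocks i) (part H i).
Proof.
apply/and3P; split.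
- rewrite eqEsubset; apply/andP; split.
    by apply/bigcupsP => B /imsetP[x _ ->]; exact: block_sub.
  apply/subsetP => v; rewrite partE => /imsetP[x _ ->].
  by apply/bigcupP; exists (block i x); [exact: imset_f | rewrite mem_block].
- apply/trivIsetP => B B' /imsetP[x _ ->] /imsetP[y _ ->]; apply: contraR.
  rewrite -setI_eq0 => /set0Pn[v]; rewrite inE => /andP[/imsetP[z zx ->]].
  rewrite inE in zx; rewrite mem_block (eqP zx) => /eqP xy.
  by apply/eqP; rewrite /block xy.
- apply/imsetP => -[x _ B0]; have : phi i x \in block i x by rewrite mem_block.
  by rewrite -B0 inE.
Qed.

Lemma card_blocks i : (#|blocks i| <= K)%N.
Proof.
rewrite -[leqRHS](card_ord K).
apply: leq_trans (subset_leq_card (_ : _ \subset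
  [set phi i @: [set y | b i y == j] | j : 'I_K])) (leq_imset_card _ _).
by apply/subsetP => _ /imsetP[x _ ->]; apply/imsetP; exists (b i x).
Qed.

Lemma card_block i x : #|block i x| = #|[set y | b i y == b i x]|.
Proof. exact: card_imset. Qed.

(** On the cell [Phi] is a constant [c], so the mean error is [d * |1 - c| + (1 - d) * |c|] with [d]
    the density. Both weights exceed [eps] and [|1 - c| + |c| >= 1], wherever the real [c] lies. *)
Lemma nonhomogeneous_block_error (eps : R) (Phi : point -> R)
    (X : {ffun 'I_k -> {set vert H}}) :
  0 < eps ->
  (forall q q' : point, (forall i, b i (q i) = b i (q' i)) -> Phi q = Phi q') ->
  X \in family blocks -> ~~ homogeneous eps X ->
  eps * \prod_i #|X i|%:R <=
  \sum_(q : point | [forall i, phi i (q i) \in X i])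
    `|(point_set q \in edges H)%:R - Phi q|.
Proof.
move=> eps0 hPhi /familyP XP nhom.
have /choice[y hy] i : exists x, X i = block i x.
  by have /imsetP[x _ ->] := XP i; exists x.
have XA i : X i \subset part H i by rewrite hy block_sub.
pose c := Phi (finfun y).
have PhiE (q : point) : [forall i, phi i (q i) \in X i] -> Phi q = c.
  move=> /forallP qX; apply: hPhi => i; rewrite ffunE; apply/eqP.
  by rewrite -mem_block -hy.
set T := \prod_i _.
have TE : T = #|[set q : point | [forall i, phi i (q i) \in X i]]|%:R.
  by rewrite card_cell// natr_prod.
have T0 : 0 < T.
  rewrite TE ltr0n; apply/card_gt0P; exists (finfun y); rewrite inE.
  by apply/forallP => i; rewrite ffunE hy mem_block.
pose E (q : point) := point_set q \in edges H.
set S := \sum_(q | _) _.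
pose N1 : R := \sum_(q : point | [forall i, phi i (q i) \in X i]) (E q)%:R.
have N1E : N1 = density R X * T.
  rewrite density_point_set// mulfVK ?gt_eqF// /N1 -natr_sum -sum1dep_card.
  congr (_%:R); rewrite [LHS]big_mkcond [RHS]big_mkcond; apply: eq_bigr => q _.
  by rewrite /E; case: (point_set q \in _); case: ifP.
have TS : T = \sum_(q : point | [forall i, phi i (q i) \in X i]) 1.
  by rewrite TE -sum1dep_card natr_sum.
have SE : S = N1 * `|1 - c| + (T - N1) * `|c|.
  rewrite TS /N1 -sumrB !mulr_suml -big_split /=; apply: eq_bigr => q qX.
  rewrite (PhiE q qX) -/(E q); case: (E q).
    by rewrite subrr mul0r addr0 mul1r.
  by rewrite distrC !subr0 mul1r mul0r add0r.
have d0 : 0 <= density R X by rewrite mulr_ge0 ?invr_ge0 ?prodr_ge0.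
have d1 : density R X <= 1.
  rewrite -(ler_pM2r T0) -N1E mul1r TS; apply: ler_sum => q _.
  by rewrite lern1 leq_b1.
move: nhom; rewrite /homogeneous /homogeneous_density d0 d1 andbT /= negb_or -!ltNge.
move=> /andP[de dE].
have c1 : 1 <= `|1 - c| + `|c|.
  by rewrite -[leLHS]normr1 -[X in `|X|](subrK c) ler_normD.
rewrite SE N1E; have := normr_ge0 c; have := normr_ge0 (1 - c).
move: (`|1 - c|) (`|c|) c1 => u v uv u0 v0.
have : eps <= density R X * u + (1 - density R X) * v by nra.
nra.
Qed.

(** Markov's inequality on cells: a bad cell carries error at least [eps] times its volume, so total
    error [eps ^+ 2] leaves bad volume at most [eps]. *)
Lemma homogeneous_blocks (eps : R) (Phi : point -> R) :
  0 < eps ->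
  (forall q q' : point, (forall i, b i (q i) = b i (q' i)) -> Phi q = Phi q') ->
  avg (fun q => `|(point_set q \in edges H)%:R - Phi q|) <= eps ^+ 2 ->
  homogeneous_kpartition eps blocks.
Proof.
move=> eps0 hPhi hS; split; first by move=> i; exact: blocks_partition.
pose err q := `|(point_set q \in edges H)%:R - Phi q|.
have cardV : \prod_i #|part H i|%:R = #|point|%:R :> R.
  rewrite card_ffun !card_ord natrX -[in RHS](card_ord k) -prodr_const.
  by apply: eq_bigr => i _; rewrite partE card_imset// card_ord.
rewrite cardV -(ler_pM2l eps0) mulrA -expr2.
apply: (@le_trans _ _ (\sum_q err q)); last first.
  move: hS; rewrite /avg; case: (posnP #|point|) => [p0 _|p0].
    rewrite p0 mulr0 big1// => q _.
    by have := card0_eq p0 q; rewrite inE.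
  by rewrite ler_pdivrMr// ltr0n.
rewrite mulr_sumr.
pose cell (q : point) : {ffun 'I_k -> {set vert H}} := [ffun i => block i (q i)].
apply: (@le_trans _ _ (\sum_(X | (X \in family blocks) && ~~ homogeneous eps X)
    \sum_(q | cell q == X) err q)).
  apply: ler_sum => X /andP[XP nhom].
  apply: le_trans (nonhomogeneous_block_error eps0 hPhi XP nhom) _.
  rewrite le_eqVlt; apply/orP; left; apply/eqP/eq_bigl => q.
  apply/forallP/eqP => [qX|<- i]; last by rewrite ffunE mem_block.
  apply/ffunP => i; rewrite ffunE.
  have /imsetP[x _ Xx] := familyP XP i.
  by have := qX i; rewrite Xx mem_block /block => /eqP ->.
rewrite (partition_big cell xpredT)//= [leRHS](bigID (fun X => (X \in family blocks) && ~~ homogeneous eps X)) /=.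
by rewrite lerDl sumr_ge0// => X _; rewrite sumr_ge0// => q _; exact: normr_ge0.
Qed.

End Blocks.

(** The coordinates of [q] outside [i] and [j], enumerated through the complement of [[set i; j]],
    are the [k - 2] vertices whose link is taken. *)
Lemma link_row_structured (g r : R) (q : point) (i j : 'I_k) :
  (0 < n)%N -> 0 <= g -> i != j ->
  (forall (v : 'I_(k - 2) -> vert H) (p : 'I_(k - 2) -> 'I_k) (i j : 'I_k),
     injective p -> (forall l, v l \in part H (p l)) -> i != j ->
     (forall l, p l != i /\ p l != j) ->
     has_bip_homogeneous_partition (link v) g r (part H i) (part H j)) ->
  row_structured (Num.truncn r) (2 * g)
    (fun x y => point_set (upd (upd q i x) j y) \in edges H).
Proof.
move=> n0 g0 ij hH.
have cardC : (k - 2)%N = #|~: [set i; j]|.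
  by rewrite cardsCs setCK cards2 ij card_ord.
pose p (l : 'I_(k - 2)) : 'I_k := enum_val (cast_ord cardC l).
have p_inj : injective p by move=> l l' /enum_val_inj /cast_ord_inj.
have p_ij l : p l != i /\ p l != j.
  have : p l \in ~: [set i; j] by exact: enum_valP.
  by rewrite !inE negb_or => /andP[].
pose v l := phi (p l) (q (p l)).
have hL := hH v p i j p_inj (fun l => phi_part _ _) ij p_ij.
have := bip_row_structured (@phi_inj i) (@phi_inj j) (partE i) (partE j) n0 g0 hL.
rewrite (_ : (fun x y => link v (phi i x) (phi j y)) =
   (fun x y => point_set (upd (upd q i x) j y) \in edges H))//.
apply/funext => x; apply/funext => y; rewrite /link; congr (in_mem _ _).
apply/setP => w; rewrite !inE; apply/idP/imsetP => [|[l _ ->]].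
  case/orP => [/orP[]/eqP ->|/imsetP[l _ ->]].
  - by exists i; rewrite // upd_neq// updE.
  - by exists j; rewrite // updE.
  - have [li lj] := p_ij l; by exists (p l); rewrite // !upd_neq.
case: (eqVneq l j) => [->|lj]; first by rewrite updE eqxx orbT.
rewrite upd_neq//; case: (eqVneq l i) => [->|li]; first by rewrite updE eqxx.
rewrite upd_neq//; apply/orP; right; apply/imsetP.
have lC : l \in ~: [set i; j] by rewrite !inE negb_or li lj.
exists (cast_ord (esym cardC) (enum_rank_in lC l)) => //.
by rewrite /v /p cast_ordKV enum_rankK_in.
Qed.

End Transfer.

(** * Size bounds and the choice of constants *)

Lemma exp2_size_bound (R : realType) (rho : R) (r M s A : nat) :
  2 <= rho -> r%:R <= rho -> M%:R <= rho ^+ A ->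
  (r * M ^ s + M)%:R <= rho ^+ (A * s + A + 2).
Proof.
move=> rho2 rr MA.
have rho1 : 1 <= rho by lra.
have rho0 : 0 <= rho by lra.
rewrite natrD natrM natrX.
have h1 : r%:R * M%:R ^+ s <= rho ^+ (A * s + A + 1).
  apply: (@le_trans _ _ (rho * rho ^+ (A * s))).
    by rewrite ler_pM ?exprn_ge0// exprM lerXn2r ?nnegrE ?exprn_ge0.
  by rewrite -exprS ler_weXn2l//; lia.
have h2 : M%:R <= rho ^+ (A * s + A + 1).
  by apply: le_trans MA _; rewrite ler_weXn2l//; lia.
rewrite (_ : A * s + A + 2 = (A * s + A + 1).+1)%N; last by lia.
rewrite exprS; apply: le_trans (lerD h1 h2) _.
by rewrite -mulr2n -mulr_natl ler_wpM2r ?exprn_ge0.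
Qed.

Lemma ler_pow2_powR (R : realType) (t : R) (N C : nat) :
  1 <= t -> N%:R <= t ^+ C -> (2 ^ N)%:R <= 2 `^ (t `^ C%:R) :> R.
Proof.
move=> t1 hN; rewrite natrX -powR_mulrn//.
by rewrite ler_powR ?ler1n// powR_mulrn// (le_trans ler01).
Qed.

Theorem theorem1p4 (R : realType) (k : nat) (hk : (3 <= k)%N) :
  exists c C : R, 0 < c /\
  forall (eps r : R) (n : nat) (H : kpartite_kgraph k),
    0 < eps < 1 / 2 ->
    1 <= r ->
    (forall i, #|part H i| = n) ->
    (forall (v : 'I_(k - 2) -> vert H) (p : 'I_(k - 2) -> 'I_k) (i j : 'I_k),
       injective p ->
       (forall l, v l \in part H (p l)) ->
       i != j ->
       (forall l, p l != i /\ p l != j) ->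
       has_bip_homogeneous_partition (link v) (c * eps ^+ 6) r
         (part H i) (part H j)) ->
    exists P : 'I_k -> {set {set vert H}},
      [/\ homogeneous_kpartition eps P,
          equitable P &
          forall i, #|P i|%:R <= 2 `^ ((r / eps) `^ C)].
Proof.
have k0 : 0 < k%:R :> R by rewrite ltr0n; lia.
(* Chosen so that the error [2 * k * (13 ^ (k - 2) + 1) * e] of [cube_regular], with
   [e = 2 * eps ^ 6 / W], is exactly [eps ^ 6]; the factor 2 in [e] comes from
   [bip_row_structured]. *)
pose W : R := 4 * k%:R * (13 ^+ (k - 2) + 1).
have W1 : 1 <= W.
  have : 1 <= 13 ^+ (k - 2) :> R by rewrite exprn_ege1 ?ler1n.
  have : 1 <= k%:R :> R by rewrite ler1n; lia.
  rewrite /W; nra.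
have W0 : 0 < W by lra.
pose a := Num.truncn (4 * W ^+ 2 + 1).
(* The exponent with [m + m <= rho ^+ B]: 1 for the doubling, [a + 1] for the constant
   [4 * W ^+ 2 + 1], and 12 for the power of [eps] in [x]. *)
pose B := (a + 14)%N.
exists W^-1, (B * (k - 2) + B + 2)%:R; split; first by rewrite invr_gt0.
move=> eps r n H /andP[eps0 eps12] r1 cardH hH.
have epsV : 2 < eps^-1 by rewrite -[ltLHS]invrK ltf_pV2 ?posrE ?invr_gt0//; lra.
pose rho := r / eps.
have rho2 : 2 <= rho by rewrite /rho; nra.
have r_rho : r <= rho by rewrite /rho; nra.
pose e := 2 * (W^-1 * eps ^+ 6).
have g0 : 0 < W^-1 * eps ^+ 6 by rewrite mulr_gt0 ?invr_gt0 ?exprn_gt0.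
have e0 : 0 < e by rewrite mulr_gt0.
(* Empty parts admit only the empty partition. *)
have [n0|n0] := posnP n.
  exists (fun _ => set0); split.
  - split=> [i|].
      have -> : part H i = set0 by apply/eqP; rewrite -cards_eq0 cardH n0.
      by apply/and3P; split; rewrite ?/cover ?big_set0// ?inE//; apply/trivIsetP => ?; rewrite inE.
    rewrite big1; first by rewrite mulr_ge0 ?prodr_ge0// ltW.
    move=> X /andP[/familyP XP _].
    have i0 : 'I_k by apply: (@Ordinal k 0); lia.
    by have := XP i0; rewrite inE.
  - by move=> i B1 B2; rewrite inE.
  - by move=> i; rewrite cards0 powR_ge0.
pose rN := Num.truncn r.
have rN0 : (0 < rN)%N by rewrite truncn_gt0.
have rN1 : 1 <= rN%:R :> R by rewrite ler1n.
have rNr : rN%:R <= r by rewrite truncn_le//; lra.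
pose x : R := 16 * rN%:R ^+ 4 / e ^+ 2.
pose m := (Num.truncn x).+1.
have xm : x <= m%:R by rewrite ltW// truncnS_gt.
have rN4 : 1 <= rN%:R ^+ 4 :> R by rewrite exprn_ege1.
have eps6 : eps ^+ 6 <= eps ^+ 2 by rewrite ler_wiXn2l// ?ltW//; lra.
have x0 : 0 <= x by rewrite mulr_ge0 ?invr_ge0 ?exprn_ge0 ?ltW//; lra.
have mx : m%:R <= x + 1 by rewrite -natr1 lerD2r truncn_le.
have e1 : e <= 1.
  have : W^-1 <= 1 by rewrite invf_le1.
  have : 0 < W^-1 by rewrite invr_gt0.
  have : eps ^+ 2 <= 1 / 2 by rewrite expr2; nra.
  have : 0 < eps ^+ 6 by rewrite exprn_gt0.
  rewrite /e; nra.
have xE : x = 4 * W ^+ 2 * (rN%:R ^+ 4 * eps^-1 ^+ 12).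
  rewrite /x /e; field; rewrite !gt_eqF//=.
have mB : (m + m)%:R <= rho ^+ B.
  have h1 : rN%:R ^+ 4 * eps^-1 ^+ 12 <= rho ^+ 12.
    rewrite /rho exprMn ler_wpM2r//; first by rewrite exprn_ge0// invr_ge0 ltW.
    apply: (@le_trans _ _ (r ^+ 4)); last by rewrite ler_weXn2l.
    by rewrite lerXn2r ?nnegrE//; lra.
  have h2 : 1 <= rho ^+ 12 by rewrite exprn_ege1//; lra.
  have h3 : 4 * W ^+ 2 + 1 <= rho ^+ a.+1.
    apply: (@le_trans _ _ (2 ^+ a.+1)); last by rewrite lerXn2r ?nnegrE//; lra.
    apply: (@le_trans _ _ a.+1%:R); first by rewrite ltW// truncnS_gt.
    by rewrite -natrX ler_nat ltnW// ltn_expl.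
  have W2 : 0 <= W ^+ 2 by rewrite sqr_ge0.
  have -> : rho ^+ B = rho * (rho ^+ a.+1 * rho ^+ 12).
    by rewrite -exprD -exprS; congr (rho ^+ _); rewrite /B addnS addSn addnS.
  clearbody a; rewrite natrD.
  have h4 : m%:R <= rho ^+ a.+1 * rho ^+ 12.
    apply: (@le_trans _ _ ((4 * W ^+ 2 + 1) * rho ^+ 12)).
      by apply: le_trans mx _; rewrite xE; nra.
    by rewrite ler_wpM2r//; lra.
  have : 0 <= m%:R :> R by rewrite ler0n.
  nra.
pose N := (rN ^ ((m + m) ^ (k - 2)))%N.
(* The two summands serve the two factors of [2 * N / e]: [2 ^ rN] exceeds [rN], which handles [N],
   and [2 ^ (m + m)] exceeds [m + m], which is at least [2 / e]. *)
pose E := (rN * (m + m) ^ (k - 2) + (m + m))%N.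
pose K0 := (2 ^ E)%N.
have hK : 2 * N%:R / e <= K0%:R.
  rewrite mulrAC mulrC /K0 /E expnD natrM ler_pM ?divr_ge0 ?ler0n ?(ltW e0)//.
    by rewrite ler_nat expnM leq_exp2r ?expn_gt0 ?addn_gt0// ltnW// ltn_expl.
  apply: (@le_trans _ _ (m + m)%:R); last by rewrite ler_nat ltnW// ltn_expl.
  have xe : x * e = 16 * rN%:R ^+ 4 / e by rewrite /x; field; rewrite gt_eqF.
  have : 1 / e <= x.
    rewrite ler_pdivrMr// xe ler_pdivlMr//; lra.
  by rewrite natrD; lra.
pose phi (i : 'I_k) (y : 'I_n) : vert H := enum_val (cast_ord (esym (cardH i)) y).
have phi_inj i : injective (phi i) by move=> y y' /enum_val_inj /cast_ord_inj.
have partE i : part H i = [set phi i y | y : 'I_n].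
  apply/setP => v; apply/idP/imsetP => [vi|[y _ ->]]; last exact: enum_valP.
  exists (cast_ord (cardH i) (enum_rank_in vi v)) => //.
  by rewrite /phi cast_ordK enum_rankK_in.
have hF q i j (ij : i != j) := link_row_structured phi_inj partE q n0 (ltW g0) ij hH.
have k1 : (1 < k)%N by exact: ltnW.
have [K [b [Phi [KK0 heq hPhi herr]]]] := @cube_regular R n k rN m K0 e
  (fun q => point_set phi q \in edges H) k1 n0 rN0 e0 xm hK hF.
exists (blocks phi b); split.
- apply: (homogeneous_blocks phi_inj partE eps0 hPhi); apply: le_trans herr _.
  (* The error [eps ^ 6] is more than small enough for the [eps ^ 2] that [homogeneous_blocks] asks
     for. *)
  apply: le_trans eps6; rewrite le_eqVlt; apply/orP; left; apply/eqP.
  transitivity (W / W * eps ^+ 6); first by rewrite /e {2}/W; ring.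
  by rewrite divff ?mul1r// gt_eqF.
- move=> i _ _ /imsetP[y _ ->] /imsetP[z _ ->].
  by rewrite !card_block.
- have rho1 : 1 <= rho by apply: le_trans rho2; rewrite ler1n.
  have hE := exp2_size_bound (k - 2) rho2 (le_trans rNr r_rho) mB.
  move=> i; apply: le_trans (ler_pow2_powR rho1 hE).
  by rewrite ler_nat; apply: leq_trans (card_blocks phi b i) KK0.
Qed.
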